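(* Let $(M,\mathcal{F})$ be a foliated manifold, let $h:\nu^*\mathcal{F}\to TM$ be a tame hamiltonian structure on $(M,\mathcal{F})$ and let $E$ be an image extension of $h$ as required in the definition of tameness. Then the bracket $$\{f,g\}':=\langle H(d'f),dg\rangle,\qquad f,g\in C^\infty(M),$$ defines a Poisson structure on the manifold $M$.
   Context: Everything is $C^\infty$. $\nu^*\mathcal{F}\subseteq T^*M$ is the annihilator of $T\mathcal{F}$. Projectable $1$-forms are the sections of $\nu^*\mathcal F$ that are locally pullbacks of $1$-forms of the local leaf space of $\mathcal{F}$; foliated vector fields are those $X$ with $[X,Y]$ tangent to $\mathcal{F}$ whenever $Y$ is. A hamiltonian structure of $\mathcal{F}$ is a vector bundle morphism $h:\nu^*\mathcal{F}\to TM$, skew symmetric in the sense that $\langle\alpha,h\beta\rangle=-\langle\beta,h\alpha\rangle$ for all $\alpha,\beta\in\nu^*_x\mathcal{F}$, $x\in M$, such that, over every open subset of $M$, the induced map $H$ on sections sends projectable $1$-forms to foliated vector fields and satisfies $$[H,H](\alpha,\beta,\gamma)=2\sum_{Cycl(\alpha,\beta,\gamma)}\langle H(L_{H\alpha}\beta),\gamma\rangle=0$$ for all projectable $1$-forms $\alpha,\beta,\gamma$, where $L$ is the Lie derivative. Put $\mathcal{H}_0:=\operatorname{im}h$. The structure $h$ is tame if there exists a differentiable distribution $E$ (an image extension) with $E\oplus T\mathcal{F}=TM$, $\mathcal{H}_0\subseteq E$, and such that all the brackets of differentiable vector fields that belong to $\mathcal{H}_0$ are contained in $E$; in the tame case only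 such $E$ are used. Given $TM=E\oplus T\mathcal{F}$, let $p_E$ be the projection onto $E$ and $d'f:=df\circ p_E$, which is a section of $\nu^*\mathcal{F}$ (a form of bidegree $(1,0)$). $H$ denotes the $C^\infty(M)$-linear map induced by $h$ on all sections of $\nu^*\mathcal{F}$. *)

(* Defs.v *)
From HB Require Import structures.
From mathcomp Require Import all_boot all_order all_algebra.
From mathcomp Require Import all_classical all_reals all_analysis.

Set Implicit Arguments.
Unset Strict Implicit.
Unset Printing Implicit Defensive.

Import Order.TTheory GRing.Theory Num.Theory.
Import numFieldNormedType.Exports.

Local Open Scope classical_set_scope.
Local Open Scope ring_scope.

Section SmoothMaps.
Context {R : realType} {V W : normedModType R}.

(* For U open: f is of class C^0 when continuous, and of class C^(k+1) when it
   is differentiable and all its directional derivatives are of class C^k. *)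
Fixpoint Ck_on (k : nat) (U : set V) (f : V -> W) : Prop :=
  match k with
  | 0 => forall u, U u -> {for u, continuous f}
  | k'.+1 => (forall u, U u -> differentiable f u) /\
             (forall v : V, Ck_on k' U ('D_v f))
  end.

Definition smooth_on (U : set V) (f : V -> W) : Prop := forall k, Ck_on k U f.

End SmoothMaps.

(* Foliations have leaf dimension p and codimension q.  The model space is
   R^(p + q) = R^p x R^q; lsubmx gives the leaf coordinates of a point and
   rsubmx its transverse coordinates. *)

Record chart (R : realType) (p q : nat) (M : topologicalType) := Chart {
  cdom : set M;
  cmap :> M -> 'rV[R]_(p + q);
  cinv : 'rV[R]_(p + q) -> M;
  cdom_open : open cdom;
  cimg_open : open (cmap @` cdom);
  cmapK : forall x, cdom x -> cinv (cmap x) = x;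
  cmap_continuous : forall x, cdom x -> {for x, continuous cmap};
  cinv_continuous : forall u, (cmap @` cdom) u -> {for u, continuous cinv} }.

Definition transition (R : realType) (p q : nat) (M : topologicalType)
    (c c' : chart R p q M) : 'rV[R]_(p + q) -> 'rV[R]_(p + q) :=
  c' \o cinv c.

(* Transitions are smooth and locally of the form (x, y) |-> (f(x, y), g(y)). *)
Definition foliated_compatible (R : realType) (p q : nat) (M : topologicalType)
    (c c' : chart R p q M) : Prop :=
  smooth_on (c @` (cdom c `&` cdom c')) (transition c c') /\
  forall u, (c @` (cdom c `&` cdom c')) u ->
    exists2 N, nbhs u N & forall v w, N v -> N w -> rsubmx v = rsubmx w ->
      rsubmx (transition c c' v) = rsubmx (transition c c' w).

(* A foliated atlas carries both the smooth structure of M and the foliation.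
   [chart_at] selects a foliated chart around each point; it only serves to fix
   a basis of each tangent space (see below). *)
Record foliatedManifold (R : realType) (p q : nat) := FoliatedManifold {
  fcarrier :> topologicalType;
  fol_hausdorff : hausdorff_space fcarrier;
  fol_second_countable : @second_countable fcarrier;
  fol_atlas : set (chart R p q fcarrier);
  fol_compatible : forall c c', fol_atlas c -> fol_atlas c' ->
    foliated_compatible c c';
  chart_at : fcarrier -> chart R p q fcarrier;
  chart_at_atlas : forall x, fol_atlas (chart_at x);
  chart_at_dom : forall x, cdom (chart_at x) x }.

Section FoliatedManifolds.
Context {R : realType} {p q : nat} {M : foliatedManifold R p q}.
Implicit Types (x : M) (U : set M) (c : chart R p q M) (f g : M -> R).

(* T_x M is identified with R^(p + q) through the chart [chart_at x]: tangent
   vectors at x are row vectors (components w.r.t. the coordinate basis of that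
   chart) and covectors at x are column vectors (w.r.t. the dual basis).  All
   smoothness conditions are expressed in arbitrary charts of the atlas, so no
   regularity of x |-> chart_at x is involved. *)
Local Notation tvec := ('rV[R]_(p + q)).
Local Notation covec := ('cV[R]_(p + q)).
Implicit Types (X Y : M -> tvec) (a b : M -> covec).

Definition pairing (al : covec) (v : tvec) : R := (v *m al) ord0 ord0.

Definition smooth_fun f : Prop :=
  forall c, fol_atlas c -> smooth_on (c @` cdom c) (f \o cinv c : _ -> R^o).

Definition dfun f x : covec :=
  \col_i 'D_(delta_mx ord0 i) (f \o cinv (chart_at x) : _ -> R^o)
    (chart_at x x).

(* The matrix, acting on row vectors on the right, of the differential at x of
   a map from M to R^m. *)
Definition dmap (m : nat) (F : M -> 'rV[R]_m) x : 'M[R]_(p + q, m) :=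
  'J (F \o cinv (chart_at x)) (chart_at x x).

Definition vrep c X (u : 'rV[R]_(p + q)) : tvec :=
  X (cinv c u) *m dmap c (cinv c u).

(* Coordinate expression of a 1-form, i.e. its pullback by the inverse of c. *)
Definition crep c a (u : 'rV[R]_(p + q)) : covec :=
  'J (transition c (chart_at (cinv c u))) u *m a (cinv c u).

Definition smooth_vfield U X : Prop :=
  forall c, fol_atlas c -> smooth_on (c @` (U `&` cdom c)) (vrep c X).

Definition smooth_form U a : Prop :=
  forall c, fol_atlas c -> smooth_on (c @` (U `&` cdom c)) (crep c a).

(* [X, Y]^i = X^j d_j Y^i - Y^j d_j X^i *)
Definition lie_bracket X Y x : tvec :=
  let c := chart_at x in
  'D_(vrep c X (c x)) (vrep c Y) (c x) - 'D_(vrep c Y (c x)) (vrep c X) (c x).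

(* (L_X b)_i = X^j d_j b_i + (d_i X^j) b_j *)
Definition lie_derivative X b x : covec :=
  let c := chart_at x in
  'D_(vrep c X (c x)) (crep c b) (c x) + 'J (vrep c X) (c x) *m crep c b (c x).

(* Subspaces of T_x M are row spaces of square matrices. The tangent space of
   the leaf is the kernel of the differential of the transverse coordinates. *)
Definition TF x : 'M[R]_(p + q) := kermx (dmap (rsubmx \o chart_at x) x).

Definition conormal x (al : covec) : Prop :=
  forall v : tvec, (v <= TF x)%MS -> pairing al v = 0.

Definition conormal_section U a : Prop :=
  smooth_form U a /\ forall x, U x -> conormal x (a x).

(* Over a small open set N the local leaf space is the image of N in R^q under
   the transverse coordinates rsubmx \o c of a foliated chart c; b is a 1-form
   on this image, and the last equation says that a is its pullback on N. *)
Definition projectable_form U a : Prop :=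
  conormal_section U a /\
  forall x, U x -> exists c (N : set M) (b : 'rV[R]_q -> 'cV[R]_q),
    [/\ fol_atlas c, open_nbhs x N, N `<=` U `&` cdom c,
        smooth_on ((rsubmx \o c) @` N) b
      & forall y, N y -> a y = dmap (rsubmx \o c) y *m b (rsubmx (c y))].

Definition tangent_vfield U X : Prop :=
  smooth_vfield U X /\ forall x, U x -> (X x <= TF x)%MS.

Definition foliated_vfield U X : Prop :=
  smooth_vfield U X /\
  forall Y, tangent_vfield U Y -> forall x, U x -> (lie_bracket X Y x <= TF x)%MS.

(* A bundle morphism nu^* F -> T M is represented by a family of maps on the
   whole cotangent spaces, of which only the values on conormal covectors
   are ever used. *)
Implicit Type h : M -> covec -> tvec.

Definition Hmap h a : M -> tvec := fun x => h x (a x).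

Definition bundle_morphism h : Prop :=
  (forall x (r : R) (al be : covec), conormal x al -> conormal x be ->
     h x (r *: al + be) = r *: h x al + h x be) /\
  (forall U a, open U -> conormal_section U a -> smooth_vfield U (Hmap h a)).

Definition HH_term h (a b g : M -> covec) x : R :=
  pairing (g x) (Hmap h (lie_derivative (Hmap h a) b) x).

Definition HH_bracket h (a b g : M -> covec) x : R :=
  2 * (HH_term h a b g x + HH_term h b g a x + HH_term h g a b x).

Record hamiltonian_structure h : Prop := {
  ham_morphism : bundle_morphism h;
  ham_skew : forall x (al be : covec), conormal x al -> conormal x be ->
    pairing al (h x be) = - pairing be (h x al);
  ham_foliated : forall U a, open U -> projectable_form U a ->
    foliated_vfield U (Hmap h a);
  ham_jacobi : forall U (a b g : M -> covec), open U ->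
    projectable_form U a -> projectable_form U b -> projectable_form U g ->
    forall x, U x -> HH_bracket h a b g x = 0 }.

Definition in_image h x (v : tvec) : Prop :=
  exists2 al, conormal x al & v = h x al.

Implicit Type E : M -> 'M[R]_(p + q).

Definition smooth_distribution E : Prop :=
  forall x, exists (N : set M) (m : nat) (X : 'I_m -> M -> tvec),
    [/\ open_nbhs x N, forall i, smooth_vfield N (X i)
      & forall y, N y -> (E y :=: \matrix_(i < m) X i y)%MS].

Record image_extension h E : Prop := {
  ext_smooth : smooth_distribution E;
  ext_disjoint : forall x, (E x :&: TF x)%MS = 0;
  ext_full : forall x, (E x + TF x :=: 1%:M)%MS;
  ext_image : forall x (v : tvec), in_image h x v -> (v <= E x)%MS;
  ext_bracket : forall U X Y, open U ->
    smooth_vfield U X -> (forall x, U x -> in_image h x (X x)) ->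
    smooth_vfield U Y -> (forall x, U x -> in_image h x (Y x)) ->
    forall x, U x -> (lie_bracket X Y x <= E x)%MS }.

Definition tame h : Prop := exists E, image_extension h E.

Definition projE E x : 'M[R]_(p + q) := proj_mx (E x) (TF x).

(* Pairing with v gives pairing (dfun f x) (v *m projE E x) = df (p_E v). *)
Definition dprime E f x : covec := projE E x *m dfun f x.

Definition bracket' h E f g : M -> R :=
  fun x => pairing (dfun g x) (Hmap h (dprime E f) x).

Record poisson_structure (B : (M -> R) -> (M -> R) -> M -> R) : Prop := {
  poisson_smooth : forall f g, smooth_fun f -> smooth_fun g ->
    smooth_fun (B f g);
  poisson_linear : forall (r : R) f g k,
    smooth_fun f -> smooth_fun g -> smooth_fun k -> forall x,
    B (fun y => r * f y + g y) k x = r * B f k x + B g k x;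
  poisson_skew : forall f g, smooth_fun f -> smooth_fun g -> forall x,
    B f g x = - B g f x;
  poisson_leibniz : forall f g k,
    smooth_fun f -> smooth_fun g -> smooth_fun k -> forall x,
    B f (fun y => g y * k y) x = B f g x * k x + g x * B f k x;
  poisson_jacobi : forall f g k,
    smooth_fun f -> smooth_fun g -> smooth_fun k -> forall x,
    B (B f g) k x + B (B g k) f x + B (B k f) g x = 0 }.

End FoliatedManifolds.

(* Main.v *)
Require Import Defs.
From HB Require Import structures.
From mathcomp Require Import all_boot all_order all_algebra.
From mathcomp Require Import all_classical all_reals all_analysis.
From mathcomp Require Import ring.

(* The key is to prove the Jacobi identity at a point x in the coordinates of
   the chart [chart_at x], where the bracket becomes
   {f, g}' = (grad f)^T L (grad g) for a skew matrix function L; with P the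
   matrix of the projection p_E one has L P = L, as im h lies in E.  The second
   derivatives of f, g, k cancel in the cyclic sum (Schwarz), which leaves the
   trilinear, cyclically invariant expression
     J(a, b, c) = sum over cyclic permutations of a^T (D_(Lc) L) b.
   It equals a^T (D_(Lc) L) b - [a^T L, b^T L] c, and by tameness the bracket of
   the two fields a^T L and b^T L of H_0 lies in E, so that
   J(a, b, c) = J(a, b, P c) and hence J(a, b, c) = J(P a, P b, P c).  Now P a,
   P b, P c are coefficients of constant conormal, thus projectable, forms, and
   on these J is half of [H, H] (the differential of (P a)^T L (P b) being
   conormal, since H maps projectable forms to foliated fields).  Smoothness of
   the bracket comes from an explicit formula for P in terms of a local
   generating family of E. *)

Set Implicit Arguments.
Unset Strict Implicit.
Unset Printing Implicit Defensive.

Import Order.TTheory GRing.Theory Num.Theory.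
Import numFieldNormedType.Exports.

Local Open Scope classical_set_scope.
Local Open Scope ring_scope.

(** * Calculus of smooth maps *)

(** The difference [g - f] vanishes near [a], so it is [o(id)] there and has differential 0; then
    [g = f + (g - f)]. *)
Lemma near_eq_differentiable (R : numFieldType) (V W : normedModType R)
    (f g : V -> W) (a : V) :
  {near a, f =1 g} -> differentiable f a -> differentiable g a.
Proof.
move=> fg df.
have d0 : is_diff a (g - f) 0.
  suff H : (g - f) \o shift a = cst ((g - f) a) + \0 +o_ 0 id.
    have c0 : continuous (\0 : V -> W) by exact: cst_continuous.
    have E := diff_unique c0 H.
    by apply: DiffDef; [apply/diff_locallyP; rewrite E | rewrite E].
  apply/eqaddoP => /= e e0.
  have fga : f a = g a by exact: (nbhs_singleton fg).
  near=> x.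
  rewrite /= !fctE /= fga subrr addr0 subr0.
  rewrite (_ : f (x + a) = g (x + a)).
    by rewrite subrr normr0 mulr_ge0 ?normr_ge0// ltW.
  near: x; move: fg; rewrite (near_shift 0 a)/= subr0.
  exact.
have -> : g = f + (g - f) by rewrite addrC subrK.
by apply: differentiableD => //; apply: ex_diff.
Unshelve. all: by end_near. Qed.

Lemma eq_on_near (V W : topologicalType) (U : set V) (f g : V -> W) u :
  open U -> (forall v, U v -> f v = g v) -> U u -> {near u, f =1 g}.
Proof.
move=> oU fg Uu; apply: filterS (open_nbhs_nbhs (conj oU Uu)) => v; exact: fg.
Qed.

Section Smooth.
Context {R : realType} {V : normedModType R}.
Implicit Types (W : normedModType R) (U : set V).

Lemma Ck_on_sub W k U U' (f : V -> W) : U' `<=` U -> Ck_on k U f -> Ck_on k U' f.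
Proof.
elim: k f => [|k IH] f sU /=; first by move=> H u /sU /H.
by move=> [df Hf]; split=> [u /sU /df //|v]; exact: IH sU (Hf v).
Qed.

(** Continuity, differentiability and derivatives at [u] are taken in the whole space [V], so what
    is known on a piece [N] at its points is already what [U] asks for. *)
Lemma Ck_on_bigcup W k U (f : V -> W) :
  (forall u, U u -> exists2 N, N u & Ck_on k N f) -> Ck_on k U f.
Proof.
elim: k f => [|k IH] f H /=; first by move=> u /H[N Nu]; apply.
split=> [u /H[N Nu [dfN _]]|v]; first exact: dfN.
by apply: IH => u /H[N Nu [_ Nf]]; exists N => //; exact: Nf.
Qed.

Lemma eq_Ck_on W k U (f g : V -> W) : open U ->
  (forall u, U u -> f u = g u) -> Ck_on k U f -> Ck_on k U g.
Proof.
elim: k f g => [|k IH] f g oU fg /=.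
  move=> H u Uu; have fgu := eq_on_near oU fg Uu.
  rewrite /prop_for /continuous_at -(fg u Uu); apply: cvg_trans (H u Uu).
  by apply: near_eq_cvg; exact: fgu.
move=> [df Hf]; split=> [u Uu|v].
  exact: near_eq_differentiable (eq_on_near oU fg Uu) (df u Uu).
apply: IH (Hf v) => // u Uu; apply: near_eq_derive.
exact: eq_on_near oU fg Uu.
Qed.

Lemma Ck_onW W k U (f : V -> W) : Ck_on k.+1 U f -> Ck_on k U f.
Proof.
elim: k f => [|k IH] f; first by move=> [df _] u /df /differentiable_continuous.
by move=> [df Hf]; split=> // v; apply: IH.
Qed.

Lemma Ck_on_cst W k U (w : W) : Ck_on k U (fun=> w).
Proof.
elim: k w => [|k IH] w /=; first by move=> u _; exact: cst_continuous.
split=> [u _|v]; first exact: differentiable_cst.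
by rewrite (_ : 'D_v _ = fun=> 0)//; apply/funext => u; exact: derive_cst.
Qed.

Lemma Ck_on_add W k U (f g : V -> W) : open U ->
  Ck_on k U f -> Ck_on k U g -> Ck_on k U (fun u => f u + g u).
Proof.
move=> oU; elim: k f g => [|k IH] f g.
  by move=> cf cg u Uu; apply: continuousD; [exact: cf|exact: cg].
move=> [df Hf] [dg Hg]; split=> [u Uu|v].
  by apply: differentiableD; [exact: df|exact: dg].
apply: eq_Ck_on (IH _ _ (Hf v) (Hg v)) => // u Uu.
by rewrite [RHS](@deriveD _ _ _ f g)//; apply: diff_derivable; [exact: df|exact: dg].
Qed.

(** Induction with the Leibniz rule; the undifferentiated factors are brought down one order by
    [Ck_onW]. *)
Lemma Ck_on_mul k U (f g : V -> R^o) : open U ->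
  Ck_on k U f -> Ck_on k U g -> Ck_on k U (fun u => f u * g u : R^o).
Proof.
move=> oU; elim: k f g => [|k IH] f g.
  by move=> cf cg u Uu; apply: (@continuousM R V f g); [exact: cf|exact: cg].
move=> Hf Hg; case: (Hf) (Hg) => [df Hf'] [dg Hg']; split=> [u Uu|v].
  by apply: (@differentiableM R V f g); [exact: df|exact: dg].
have H := Ck_on_add oU (IH _ _ (Ck_onW Hf) (Hg' v)) (IH _ _ (Ck_onW Hg) (Hf' v)).
apply: eq_Ck_on H => // u Uu.
by rewrite [RHS](@deriveM R V f g)//; apply: diff_derivable; [exact: df|exact: dg].
Qed.

Lemma Ck_on_opp k U (f : V -> R^o) : open U ->
  Ck_on k U f -> Ck_on k U (fun u => - f u).
Proof.
move=> oU Hf; apply: eq_Ck_on (Ck_on_mul oU (Ck_on_cst k U (-1 : R^o)) Hf) => //.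
by move=> u _; rewrite mulN1r.
Qed.

Lemma Ck_on_sum W k U (I : Type) (r : seq I) (P : pred I) (F : I -> V -> W) :
  open U -> (forall i, P i -> Ck_on k U (F i)) ->
  Ck_on k U (fun u => \sum_(i <- r | P i) F i u).
Proof.
move=> oU H; elim: r => [|i r IH].
  by apply: eq_Ck_on (Ck_on_cst k U 0) => // u _; rewrite big_nil.
have [Pi|NPi] := boolP (P i).
  by apply: eq_Ck_on (Ck_on_add oU (H i Pi) IH) => // u _; rewrite big_cons Pi.
by apply: eq_Ck_on IH => // u _; rewrite big_cons (negbTE NPi).
Qed.

Lemma Ck_on_prod k U (I : Type) (r : seq I) (F : I -> V -> R^o) :
  open U -> (forall i, Ck_on k U (F i)) ->
  Ck_on k U (fun u => \prod_(i <- r) F i u : R^o).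
Proof.
move=> oU H; elim: r => [|i r IH].
  by apply: eq_Ck_on (Ck_on_cst k U (1 : R^o)) => // u _; rewrite big_nil.
by apply: eq_Ck_on (Ck_on_mul oU (H i) IH) => // u _; rewrite big_cons.
Qed.

(** The derivative of [1/f] is [-(1/f)^2 f'], where [1/f] has the order given by the induction
    hypothesis. *)
Lemma Ck_on_inv k U (f : V -> R^o) : open U ->
  (forall u, U u -> f u != 0) -> Ck_on k U f -> Ck_on k U (fun u => (f u)^-1 : R^o).
Proof.
move=> oU f0; elim: k => [|k IH].
  by move=> cf u Uu; apply: (@continuousV R V f); [exact: f0|exact: cf].
move=> Hf; case: (Hf) => [df Hf']; split=> [u Uu|v].
  by apply: (@differentiableV R V f); [exact: df|exact: f0].
have Hi := IH (Ck_onW Hf).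
have H := Ck_on_opp oU (Ck_on_mul oU (Ck_on_mul oU Hi Hi) (Hf' v)).
apply: eq_Ck_on H => // u Uu.
rewrite [RHS](@deriveV R V f) ?f0//; last by apply: diff_derivable; exact: df.
by rewrite scaleNr; congr (- (_ * _)); rewrite -invfM.
Qed.

Lemma continuous_sum W (I : Type) (r : seq I) (P : pred I) (F : I -> V -> W) u :
  (forall i, P i -> {for u, continuous (F i)}) ->
  {for u, continuous (fun v => \sum_(i <- r | P i) F i v)}.
Proof.
move=> H; elim: r => [|i r IH].
  rewrite (_ : (fun _ => _) = fun=> 0); first exact: cst_continuous.
  by apply/funext => v; rewrite big_nil.
have [Pi|NPi] := boolP (P i).
  rewrite (_ : (fun _ => _) = F i + (fun v => \sum_(i <- r | P i) F i v)).
    by apply: continuousD => //; exact: H.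
  by apply/funext => v; rewrite big_cons Pi.
rewrite (_ : (fun _ => _) = (fun v => \sum_(i <- r | P i) F i v))//.
by apply/funext => v; rewrite big_cons (negbTE NPi).
Qed.

(** Conversely to taking coordinates, [F] is the sum of its entries times the elementary
    matrices. *)
Lemma differentiable_mxP m n (F : V -> 'M[R]_(m, n)) u :
  differentiable F u <-> forall i j, differentiable (fun v => F v i j : R^o) u.
Proof.
split=> [dF i j|dF].
  exact: (differentiable_comp dF (differentiable_coord (F u) i j)).
have -> : F = \sum_i \sum_j (fun v => F v i j *: delta_mx i j).
  apply/funext => v; rewrite [LHS]matrix_sum_delta fct_sumE.
  by apply: eq_bigr => i _; rewrite fct_sumE.
apply: differentiable_sum => i; apply: differentiable_sum => j.
exact: (@differentiableZl R _ _ (fun v => F v i j)).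
Qed.

Lemma Ck_on_mxP m n k U (F : V -> 'M[R]_(m, n)) : open U ->
  Ck_on k U F <-> forall i j, Ck_on k U (fun v => F v i j : R^o).
Proof.
move=> oU; elim: k F => [|k IH] F.
  split=> [cF i j u Uu|cF u Uu].
    apply: (@continuous_comp _ _ _ F (fun A : 'M[R]_(m, n) => A i j)).
      exact: cF.
    exact: coord_continuous.
  have -> : F = fun v => \sum_i \sum_j (F v i j *: delta_mx i j).
    by apply/funext => v; rewrite [LHS]matrix_sum_delta.
  apply: continuous_sum => i _; apply: continuous_sum => j _.
  by apply: cvgZr_tmp; exact: cF.
have dmx v u i j : differentiable F u ->
    'D_v (fun t => F t i j : R^o) u = 'D_v F u i j.
  by move=> dF; rewrite derive_mx ?mxE//; exact: diff_derivable.
split=> [[dF HF] i j|H].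
  split=> [u Uu|v]; first by move: (dF u Uu) => /differentiable_mxP; apply.
  move: (HF v) => /IH/(_ i j) H.
  by apply: eq_Ck_on H => // u Uu; rewrite dmx//; exact: dF.
have dF u : U u -> differentiable F u.
  by move=> Uu; apply/differentiable_mxP => i j; have [+ _] := H i j; apply.
split=> // v; apply/IH => i j; have [_ /(_ v)] := H i j.
by apply: eq_Ck_on => // u Uu; rewrite dmx//; exact: dF.
Qed.

End Smooth.

Section SmoothOn.
Context {R : realType} {V : normedModType R}.
Implicit Types (W : normedModType R) (U : set V).

Lemma smooth_on_differentiable W U (f : V -> W) u :
  smooth_on U f -> U u -> differentiable f u.
Proof. by move=> /(_ 1%N)[+ _]; apply. Qed.

Lemma smooth_on_continuous W U (f : V -> W) u :
  smooth_on U f -> U u -> {for u, continuous f}.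
Proof. by move=> /(_ 0%N); apply. Qed.

Lemma smooth_on_derive W U (f : V -> W) v : smooth_on U f -> smooth_on U ('D_v f).
Proof. by move=> sf k; have [_] := sf k.+1; apply. Qed.

Lemma eq_smooth_on W U (f g : V -> W) : open U ->
  (forall u, U u -> f u = g u) -> smooth_on U f -> smooth_on U g.
Proof. by move=> oU fg sf k; apply: eq_Ck_on fg (sf k). Qed.

Lemma smooth_on_sub W U U' (f : V -> W) : U' `<=` U -> smooth_on U f -> smooth_on U' f.
Proof. by move=> sU sf k; apply: Ck_on_sub sU (sf k). Qed.

Lemma smooth_on_bigcup W U (f : V -> W) :
  (forall u, U u -> exists2 N, N u & smooth_on N f) -> smooth_on U f.
Proof. by move=> H k; apply: Ck_on_bigcup => u /H[N Nu /(_ k)]; exists N. Qed.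

Lemma smooth_on_cst W U (w : W) : smooth_on U (fun=> w).
Proof. by move=> k; apply: Ck_on_cst. Qed.

Lemma smooth_on_mul U (f g : V -> R^o) : open U ->
  smooth_on U f -> smooth_on U g -> smooth_on U (fun u => f u * g u : R^o).
Proof. by move=> oU sf sg k; apply: Ck_on_mul (sf k) (sg k). Qed.

Lemma smooth_on_inv U (f : V -> R^o) : open U ->
  (forall u, U u -> f u != 0) -> smooth_on U f ->
  smooth_on U (fun u => (f u)^-1 : R^o).
Proof. by move=> oU f0 sf k; apply: Ck_on_inv f0 (sf k). Qed.

Lemma smooth_on_sum W U (I : Type) (r : seq I) (P : pred I) (F : I -> V -> W) :
  open U -> (forall i, P i -> smooth_on U (F i)) ->
  smooth_on U (fun u => \sum_(i <- r | P i) F i u).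
Proof. by move=> oU sF k; apply: Ck_on_sum => // i Pi; apply: sF. Qed.

Lemma smooth_on_prod U (I : Type) (r : seq I) (F : I -> V -> R^o) :
  open U -> (forall i, smooth_on U (F i)) ->
  smooth_on U (fun u => \prod_(i <- r) F i u : R^o).
Proof. by move=> oU sF k; apply: Ck_on_prod => // i; apply: sF. Qed.

Lemma smooth_on_mxP m n U (F : V -> 'M[R]_(m, n)) : open U ->
  smooth_on U F <-> forall i j, smooth_on U (fun v => F v i j : R^o).
Proof.
move=> oU; split=> [sF i j k|sF k]; first by have /(Ck_on_mxP _ _ oU) := sF k.
by apply/Ck_on_mxP => // i j; apply: sF.
Qed.

Lemma smooth_on_mulmx m n l U (F : V -> 'M[R]_(m, n)) (G : V -> 'M[R]_(n, l)) :
  open U -> smooth_on U F -> smooth_on U G -> smooth_on U (fun u => F u *m G u).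
Proof.
move=> oU /(smooth_on_mxP _ oU) sF /(smooth_on_mxP _ oU) sG.
apply/smooth_on_mxP => // i j.
apply: (@eq_smooth_on _ _ (fun u => \sum_l F u i l * G u l j : R^o)) => //.
  by move=> u _; rewrite mxE.
by apply: smooth_on_sum => // l0 _; apply: smooth_on_mul.
Qed.

Lemma smooth_on_det n U (F : V -> 'M[R]_n) : open U -> smooth_on U F ->
  smooth_on U (fun u => \det (F u) : R^o).
Proof.
move=> oU /(smooth_on_mxP _ oU) sF; apply: smooth_on_sum => // s _.
apply: smooth_on_mul => //; first exact: smooth_on_cst.
exact: smooth_on_prod.
Qed.

Lemma smooth_on_invmx n U (F : V -> 'M[R]_n) : open U ->
  (forall u, U u -> F u \in unitmx) -> smooth_on U F ->
  smooth_on U (fun u => invmx (F u)).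
Proof.
move=> oU Fu sF; have /(smooth_on_mxP _ oU) sFij := sF.
apply/smooth_on_mxP => // i j.
(* Cramer's rule: the entries of the inverse are signed minors divided by the determinant. *)
apply: (@eq_smooth_on _ _ (fun u => (\det (F u))^-1 *
   ((-1) ^+ (j + i) * \det (row' j (col' i (F u)))) : R^o)) => //.
  by move=> u Uu; rewrite /invmx Fu// !mxE.
apply: smooth_on_mul => //.
  apply: smooth_on_inv (smooth_on_det oU sF) => // u /Fu.
  by rewrite unitmxE unitfE.
apply: smooth_on_mul => //; first exact: smooth_on_cst.
apply: smooth_on_det => //; apply/smooth_on_mxP => // a b.
by apply: eq_smooth_on (sFij (lift j a) (lift i b)) => // u _; rewrite !mxE.
Qed.

End SmoothOn.

(** * Chain rule and Jacobian matrices *)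

Section Composition.
Context {R : realType}.

(** A derivative along the moving vector ['D_v phi u] is expanded in fixed basis directions; in this
    form the induction on the order in [Ck_on_comp] applies to the derivatives of [f]. *)
Lemma derive_comp (n m : nat) (W : normedModType R) (f : 'rV[R]_m -> W)
    (phi : 'rV[R]_n -> 'rV[R]_m) u v :
  differentiable phi u -> differentiable f (phi u) ->
  'D_v (f \o phi) u = \sum_i 'D_v phi u ord0 i *: 'D_(delta_mx ord0 i) f (phi u).
Proof.
move=> dphi df; rewrite deriveE; last exact: differentiable_comp.
rewrite diff_comp//= -(deriveE v dphi) [in LHS](row_sum_delta ('D_v phi u)).
rewrite linear_sum; apply: eq_bigr => i _; rewrite linearZ/=.
by rewrite -(deriveE (delta_mx ord0 i) df).
Qed.

Lemma Ck_on_comp (n m k : nat) U U' (f : 'rV[R]_m -> R^o)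
    (phi : 'rV[R]_n -> 'rV[R]_m) : open U -> (forall u, U u -> U' (phi u)) ->
  Ck_on k U' f -> Ck_on k U phi -> Ck_on k U (f \o phi : _ -> R^o).
Proof.
move=> oU sU; elim: k f => [|k IH] f.
  move=> cf cphi u Uu; apply: continuous_comp; first exact: cphi.
  by apply: cf; exact: sU.
move=> [df Hf] Hphi; case: (Hphi) => [dphi Hphi']; split=> [u Uu|v].
  by apply: differentiable_comp; [exact: dphi|apply: df; exact: sU].
have H : Ck_on k U (fun u => \sum_i 'D_v phi u ord0 i *
    'D_(delta_mx ord0 i) f (phi u) : R^o).
  apply: Ck_on_sum => // i _; apply: Ck_on_mul => //.
    by have /(Ck_on_mxP _ _ oU) := Hphi' v; apply.
  exact: IH (Hf _) (Ck_onW Hphi).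
apply: eq_Ck_on H => // u Uu.
by rewrite (derive_comp _ (dphi u Uu) (df _ (sU u Uu))).
Qed.

Lemma smooth_on_comp (n m a b : nat) U U' (f : 'rV[R]_m -> 'M[R]_(a, b))
    (phi : 'rV[R]_n -> 'rV[R]_m) : open U -> open U' ->
  (forall u, U u -> U' (phi u)) ->
  smooth_on U' f -> smooth_on U phi -> smooth_on U (f \o phi).
Proof.
move=> oU oU' sU /(smooth_on_mxP _ oU') sf sphi; apply/smooth_on_mxP => // i j k.
exact: (Ck_on_comp (f := fun v => f v i j) oU sU (sf i j k) (sphi k)).
Qed.

Lemma jacobianE (n m : nat) (f : 'rV[R]_n -> 'rV[R]_m) (u : 'rV[R]_n) i :
  differentiable f u -> row i ('J f u) = 'D_(delta_mx ord0 i) f u.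
Proof. by move=> df; rewrite deriveEjacobian// -rowE. Qed.

Lemma smooth_on_jacobian (n m : nat) U (f : 'rV[R]_n -> 'rV[R]_m) : open U ->
  smooth_on U f -> smooth_on U (fun u => 'J f u).
Proof.
move=> oU sf; apply/smooth_on_mxP => // i j.
have /(smooth_on_mxP _ oU)/(_ ord0 j) := smooth_on_derive (delta_mx ord0 i) sf.
apply: eq_smooth_on => // u Uu.
by rewrite -jacobianE ?mxE//; exact: smooth_on_differentiable sf Uu.
Qed.

Lemma jacobian_comp (n m l : nat) (g : 'rV[R]_m -> 'rV[R]_l)
    (f : 'rV[R]_n -> 'rV[R]_m) u :
  differentiable f u -> differentiable g (f u) ->
  'J (g \o f) u = 'J f u *m 'J g (f u).
Proof.
move=> df dg; apply/row_matrixP => i.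
have dgf := differentiable_comp df dg.
rewrite row_mul (jacobianE i df) (jacobianE i dgf) -deriveEjacobian//.
by rewrite (deriveE _ dgf) (deriveE _ dg) (deriveE _ df) diff_comp.
Qed.

Lemma near_eq_jacobian (n m : nat) (f g : 'rV[R]_n -> 'rV[R]_m) (u : 'rV[R]_n) :
  {near u, f =1 g} -> differentiable f u -> 'J f u = 'J g u.
Proof.
move=> fg df; apply/row_matrixP => i.
have dg := near_eq_differentiable fg df.
apply: etrans (jacobianE i df) _; apply: etrans _ (esym (jacobianE i dg)).
exact: (near_eq_derive (delta_mx ord0 i) fg).
Qed.

Lemma jacobian_linear (n m : nat) (f : 'rV[R]_n -> 'rV[R]_m) (A : 'M[R]_(n, m)) u :
  (forall v, f v = v *m A) -> differentiable f u /\ 'J f u = A.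
Proof.
move=> fA; have -> : f = mulmxr A by apply/funext => v; rewrite fA.
(* Continuity of the linear map is read off its entries, through the case of order 0 of
   [Ck_on_mxP]. *)
have cA : continuous (mulmxr A : {linear 'rV[R]_n -> 'rV[R]_m}).
  move=> v; have := @Ck_on_mxP R 'rV[R]_n 1 m 0 setT (mulmxr A) openT.
  move=> [_]; apply=> // i j w _.
  rewrite (_ : (fun _ => _) = fun z : 'rV[R]_n => \sum_k z ord0 k * A k j); last first.
    by apply/funext => z; rewrite ord1 mxE.
  apply: continuous_sum => k _.
  apply: (@continuousM R 'rV[R]_n (fun z => z ord0 k) (fun=> A k j)).
    exact: coord_continuous.
  exact: cst_continuous.
split; first exact: linear_differentiable.
by apply/row_matrixP => i; rewrite !rowE /jacobian mul_rV_lin1 diff_lin.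
Qed.

End Composition.

(** * Symmetry of second derivatives *)

Section Schwarz.
Context {R : realType} {V : normedModType R}.
Implicit Types (f g : V -> R^o) (a u v w : V).

Lemma is_derive_line f a v (s : R) : differentiable f (a + s *: v) ->
  is_derive s 1 (fun t : R => f (a + t *: v) : R^o) ('D_v f (a + s *: v)).
Proof.
move=> df; have /derivableP dv := diff_derivable (v := v) df.
case: dv => dv _.
have E : (fun h : R => h^-1 *: (((fun t : R => f (a + t *: v) : R^o) \o shift s)
    (h *: 1) - f (a + s *: v))) =
    (fun h : R => h^-1 *: ((f \o shift (a + s *: v)) (h *: v) - f (a + s *: v))).
  apply/funext => h /=; congr (_ *: (f _ - _)).
  by rewrite /GRing.scale/= mulr1 -/(GRing.scale _ _) scalerDl addrCA.
by apply: DeriveDef; rewrite /derivable /derive E.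
Qed.

Lemma MVT_line f a v (r : R) : 0 < r ->
  (forall s : R, 0 <= s <= r -> differentiable f (a + s *: v)) ->
  exists2 s : R, 0 < s < r & f (a + r *: v) - f a = 'D_v f (a + s *: v) * r.
Proof.
move=> r0 df.
have dl (s : R) : 0 <= s <= r ->
    is_derive s 1 (fun t : R => f (a + t *: v) : R^o) ('D_v f (a + s *: v)).
  by move=> sr; apply: is_derive_line; exact: df.
have [||s] := @MVT R (fun t : R => f (a + t *: v)) (fun t => 'D_v f (a + t *: v)) _ _ r0.
- by move=> x; rewrite in_itv/= => /andP[x0 xr]; apply: dl; rewrite !ltW.
- apply: derivable_within_continuous => x; rewrite in_itv/= => xr.
  by case: (dl x xr).
- by rewrite in_itv/= => sr; rewrite scale0r addr0 subr0 => E; exists s.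
Qed.

Lemma derive_shiftr f a u v : 'D_v (fun x => f (x + a)) u = 'D_v f (u + a).
Proof. by rewrite /derive; under eq_fun do rewrite /= -addrA. Qed.

Lemma differentiable_shiftr f a u : differentiable f (u + a) ->
  differentiable (fun x => f (x + a) : R^o) u.
Proof.
move=> df; apply: (@differentiable_comp _ _ _ _ (fun x => x + a) f) => //.
Qed.

(** The second difference of [f] over a parallelogram, by two uses of the mean value theorem: along
    [v] for the increment of [f] in direction [w], then along [w] for ['D_v f]. *)
Lemma MVT_square f u v w (r : R) : 0 < r ->
  (forall s t : R, 0 <= s <= r -> 0 <= t <= r ->
    differentiable f (u + s *: v + t *: w) /\
    differentiable ('D_v f) (u + s *: v + t *: w)) ->
  exists s t : R, [/\ 0 < s < r, 0 < t < r &
    f (u + r *: v + r *: w) - f (u + r *: v) - (f (u + r *: w) - f u) =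
    'D_w ('D_v f) (u + s *: v + t *: w) * r * r].
Proof.
move=> r0 df; have rr : 0 <= r <= r by rewrite lexx ltW.
have r00 : 0 <= (0 : R) <= r by rewrite lexx ltW.
pose g x := f (x + r *: w) - f x : R^o.
have df1 s : 0 <= s <= r -> differentiable (fun x => f (x + r *: w) : R^o) (u + s *: v).
  by move=> sr; apply: differentiable_shiftr; have [] := df s r sr rr.
have df0 s : 0 <= s <= r -> differentiable f (u + s *: v).
  by move=> sr; have [+ _] := df s 0 sr r00; rewrite scale0r addr0.
have [||s sr Es] := @MVT_line g u v r; first exact: r0.
  by move=> s sr; apply: differentiableB; [exact: df1|exact: df0].
have sr' : 0 <= s <= r by case/andP: sr => ? ?; rewrite !ltW.
have [||t tr Et] := @MVT_line ('D_v f) (u + s *: v) w r; first exact: r0.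
  by move=> t tr; have [] := df s t sr' tr.
exists s, t; split=> //; rewrite -Et.
have -> : 'D_v f (u + s *: v + r *: w) - 'D_v f (u + s *: v) = 'D_v g (u + s *: v).
  rewrite (@deriveB _ _ _ (fun x => f (x + r *: w)) f) ?derive_shiftr//.
  - by apply: diff_derivable; exact: df1.
  - by apply: diff_derivable; exact: df0.
by rewrite -Es.
Qed.

(** If the mixed derivatives differed at [u], continuity would keep each within half the gap of its
    value at [u] on a small parallelogram, where [MVT_square] writes one second difference through
    either of them. *)
Lemma derive_sym (U : set V) f u v w : open U -> U u -> Ck_on 2 U f ->
  'D_v ('D_w f) u = 'D_w ('D_v f) u.
Proof.
have tri (e x y z z' : R) : z' = z -> `|x - z| < e -> `|y - z'| < e -> `|x - y| < e + e.
  move=> -> xz yz; rewrite -(subrK z x) -addrA.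
  by apply: le_lt_trans (ler_normD _ _) _; apply: ltrD => //; rewrite distrC.
move=> oU Uu [df Hf].
have cvw a b : {for u, continuous ('D_a ('D_b f))}.
  by have [_ /(_ a)] := Hf b; apply.
apply/eqP/negPn/negP => neq.
pose A := 'D_v ('D_w f); pose B := 'D_w ('D_v f).
pose e := `|A u - B u| / 2.
have e0 : 0 < e by rewrite divr_gt0// normr_gt0 subr_eq0.
have : \forall x \near u, [/\ U x, `|A u - A x| < e & `|B u - B x| < e].
  have HA : \forall x \near u, `|A u - A x| < e.
    by move/cvgrPdist_lt : (cvw v w); apply.
  have HB : \forall x \near u, `|B u - B x| < e.
    by move/cvgrPdist_lt : (cvw w v); apply.
  have HU : \forall x \near u, U x by exact: open_nbhs_nbhs.
  apply: filterS (filterI HU (filterI HA HB)) => x [Ux [Ax Bx]].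
  by split; [exact: Ux|exact: Ax|exact: Bx].
move=> /nbhs_ballP[d /= d0 Hd].
(* With this side, every point of the parallelogram is at distance at most [d / 2] from [u]; the
   summand 1 keeps the denominator positive when [v] and [w] are zero. *)
pose r := d / (`|v| + `|w| + 1) / 2.
have n0 : 0 < `|v| + `|w| + 1 by rewrite ltr_wpDl ?addr_ge0.
have r0 : 0 < r by rewrite !divr_gt0.
have inb (s t : R) : 0 <= s <= r -> 0 <= t <= r ->
    [/\ U (u + s *: v + t *: w), `|A u - A (u + s *: v + t *: w)| < e &
      `|B u - B (u + s *: v + t *: w)| < e].
  move=> /andP[s0 sr] /andP[t0 tr]; apply: Hd.
  rewrite -ball_normE/= -addrA opprD addrA subrr add0r normrN.
  apply: le_lt_trans (ler_normD _ _) _; rewrite !normrZ !ger0_norm//.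
  apply: (@le_lt_trans _ _ (r * (`|v| + `|w| + 1))).
    rewrite !mulrDr mulr1 -[leLHS]addr0; apply: lerD (ltW r0).
    by apply: lerD; apply: ler_wpM2r.
  by rewrite /r mulrAC divfK ?gt_eqF// ltr_pdivrMr// mulr2n mulrDr mulr1 ltrDl.
have dfU (s t : R) (a b : V) : U (u + s *: a + t *: b) ->
    differentiable f (u + s *: a + t *: b) /\
    differentiable ('D_a f) (u + s *: a + t *: b).
  by move=> Ux; split; [exact: df|have [+ _] := Hf a; apply].
have [|s [t [/andP[s0 sr] /andP[t0 tr] Est]]] := @MVT_square f u v w r r0.
  by move=> s t sr tr; apply: dfU; have [] := inb s t sr tr.
have [|s' [t' [/andP[s0' sr'] /andP[t0' tr'] Est']]] := @MVT_square f u w v r r0.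
  by move=> s1 t1 sr1 tr1; apply: dfU; rewrite addrAC; have [] := inb t1 s1 tr1 sr1.
(* Exchanging [v] and [w] leaves the second difference unchanged, so its two mean values agree after
   division by [r * r]. *)
have EAB : B (u + s *: v + t *: w) = A (u + t' *: v + s' *: w).
  move: Est'; rewrite (addrAC u (r *: w)) (addrAC u (s' *: w)) => Est'.
  have : B (u + s *: v + t *: w) * r * r = A (u + t' *: v + s' *: w) * r * r.
    apply: etrans (esym Est) _; apply: etrans _ Est'.
    by rewrite !opprB [LHS]addrACA [RHS]addrACA; congr (_ + _); exact: addrC.
  by move=> /(mulIf (lt0r_neq0 r0))/(mulIf (lt0r_neq0 r0)).
have le0r (x : R) : 0 < x -> x < r -> 0 <= x <= r by move=> x0 xr; rewrite !ltW.
have [_ _ HB] := inb s t (le0r _ s0 sr) (le0r _ t0 tr).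
have [_ HA _] := inb t' s' (le0r _ t0' tr') (le0r _ s0' sr').
have := tri _ _ _ _ _ EAB HA HB.
by rewrite -splitr ltxx.
Qed.

End Schwarz.

(** * Brackets of bivector fields on open subsets of R^n *)

Section Gradient.
Context {R : realType} {n : nat}.
Implicit Types (f g : 'rV[R]_n -> R^o) (u v : 'rV[R]_n) (U : set 'rV[R]_n).

Definition grad f u : 'cV[R]_n := \col_i 'D_(delta_mx ord0 i) f u.

Lemma derive_grad f u v :
  differentiable f u -> 'D_v f u = (v *m grad f u) ord0 ord0.
Proof.
move=> df; rewrite (deriveE _ df) [in LHS](row_sum_delta v) linear_sum mxE.
by apply: eq_bigr => i _; rewrite linearZ/= mxE (deriveE _ df).
Qed.

Lemma smooth_on_grad U f : open U -> smooth_on U f -> smooth_on U (grad f).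
Proof.
move=> oU sf; apply/smooth_on_mxP => // i j.
apply: eq_smooth_on (smooth_on_derive (delta_mx ord0 i) sf) => // u _.
by rewrite mxE.
Qed.

Lemma derive_mx_entry m l (F : 'rV[R]_n -> 'M[R]_(m, l)) u v i j :
  differentiable F u -> 'D_v F u i j = 'D_v (fun t => F t i j : R^o) u.
Proof. by move=> dF; rewrite derive_mx ?mxE//; exact: diff_derivable. Qed.

Lemma differentiable_mulmx m l o (F : 'rV[R]_n -> 'M[R]_(m, l))
    (G : 'rV[R]_n -> 'M[R]_(l, o)) u :
  differentiable F u -> differentiable G u ->
  differentiable (fun t => F t *m G t) u.
Proof.
move=> /differentiable_mxP dF /differentiable_mxP dG.
apply/differentiable_mxP => i j.
rewrite (_ : (fun _ => _) = \sum_k (fun t => F t i k * G t k j : R^o)).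
  apply: differentiable_sum => k.
  exact: (@differentiableM _ _ (fun t => F t i k) (fun t => G t k j)).
by apply/funext => t; rewrite mxE fct_sumE.
Qed.

Lemma derive_mulmx m l o (F : 'rV[R]_n -> 'M[R]_(m, l))
    (G : 'rV[R]_n -> 'M[R]_(l, o)) u v :
  differentiable F u -> differentiable G u ->
  'D_v (fun t => F t *m G t) u = 'D_v F u *m G u + F u *m 'D_v G u.
Proof.
move=> dF dG; have dFG := differentiable_mulmx dF dG.
have /differentiable_mxP dFe := dF; have /differentiable_mxP dGe := dG.
apply/matrixP => i j; rewrite (derive_mx_entry _ _ _ dFG).
rewrite (_ : (fun _ => _) =
    \sum_k ((fun t => F t i k) * (fun t => G t k j) : _ -> R^o)); last first.
  by apply/funext => t; rewrite mxE fct_sumE.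
have dM k : derivable ((fun t => F t i k) * (fun t => G t k j) : _ -> R^o) u v.
  by apply: derivableM; apply: diff_derivable; [exact: dFe|exact: dGe].
rewrite derive_sum//= !mxE -big_split/=; apply: eq_bigr => k _.
rewrite (derive_mx_entry _ _ _ dF) (derive_mx_entry _ _ _ dG).
rewrite [LHS]deriveM; last 2 first.
- by apply: diff_derivable; exact: dFe.
- by apply: diff_derivable; exact: dGe.
by rewrite addrC; congr (_ + _); exact: mulrC.
Qed.

Lemma derive_trmx m l (F : 'rV[R]_n -> 'M[R]_(m, l)) u v :
  differentiable F u -> 'D_v (fun t => (F t)^T) u = ('D_v F u)^T.
Proof.
move=> dF; have /differentiable_mxP dFe := dF.
have dFT : differentiable (fun t => (F t)^T) u.
  apply/differentiable_mxP => i j; rewrite (_ : (fun _ => _) = fun t => F t j i)//.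
  by apply/funext => t; rewrite mxE.
apply/matrixP => i j; rewrite (derive_mx_entry _ _ _ dFT) mxE.
rewrite (derive_mx_entry _ _ _ dF); congr ('D_v _ u).
by apply/funext => t; rewrite mxE.
Qed.

Definition hessian f u : 'M[R]_n :=
  \matrix_(i, j) 'D_(delta_mx ord0 i) ('D_(delta_mx ord0 j) f) u.

Lemma hessian_sym U f u : open U -> U u -> smooth_on U f ->
  (hessian f u)^T = hessian f u.
Proof.
move=> oU Uu sf; apply/matrixP => i j; rewrite !mxE.
exact: derive_sym oU Uu (sf 2%N).
Qed.

(** Entry [i] is the derivative of the i-th partial derivative along [v], which gives the transposed
    Hessian; Schwarz removes the transposition. *)
Lemma derive_gradE U f u v : open U -> U u -> smooth_on U f ->
  'D_v (grad f) u = hessian f u *m v^T.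
Proof.
move=> oU Uu sf; have sg := smooth_on_grad oU sf.
rewrite -(hessian_sym oU Uu sf) -trmx_mul; apply/matrixP => i j.
rewrite (derive_mx_entry _ _ _ (smooth_on_differentiable sg Uu)) !mxE.
rewrite (_ : (fun _ => _) = 'D_(delta_mx ord0 i) f); last first.
  by apply/funext => t; rewrite mxE.
rewrite derive_grad; last first.
  exact: smooth_on_differentiable (smooth_on_derive _ sf) Uu.
by rewrite mxE (ord1 j); apply: eq_bigr => k _; rewrite !mxE.
Qed.

End Gradient.

(** Scalars are kept as 1 x 1 matrices; this rewrites [a^T *m B *m b] as [b^T *m B^T *m a]. *)
Lemma mx11_trmx (R : pzRingType) (A : 'M[R]_1) : A^T = A.
Proof. by apply/matrixP => i j; rewrite mxE !ord1. Qed.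

(** * The Jacobi identity for a skew matrix of functions *)

Section LocalJacobi.
Context {R : realType} {n : nat} (L : 'rV[R]_n -> 'M[R]_n).
Implicit Types (f g k : 'rV[R]_n -> R^o) (u : 'rV[R]_n) (a b c : 'cV[R]_n).

Definition bivector_bracket f g u : R^o :=
  ((grad f u)^T *m L u *m grad g u) ord0 ord0.

Definition jacobi_term u a b c : 'M[R]_1 :=
  a^T *m 'D_((L u *m c)^T) L u *m b.

(** For skew [L] this is, up to a constant factor, the Schouten bracket of the bivector field [L]
    with itself, evaluated on three covectors. *)
Definition jacobiator u a b c : 'M[R]_1 :=
  jacobi_term u a b c + jacobi_term u b c a + jacobi_term u c a b.

Variable U : set 'rV[R]_n.
Hypothesis oU : open U.
Hypothesis smoothL : smooth_on U L.

Lemma smooth_on_trmx m l (F : 'rV[R]_n -> 'M[R]_(m, l)) :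
  smooth_on U F -> smooth_on U (fun u => (F u)^T).
Proof.
move=> /(smooth_on_mxP _ oU) sF; apply/smooth_on_mxP => // i j.
by apply: eq_smooth_on (sF j i) => // u _; rewrite mxE.
Qed.

Lemma smooth_bracket_mx f g : smooth_on U f -> smooth_on U g ->
  smooth_on U (fun u => (grad f u)^T *m L u *m grad g u).
Proof.
move=> sf sg; apply: smooth_on_mulmx (smooth_on_grad oU sg) => //.
by apply: smooth_on_mulmx => //; apply: smooth_on_trmx; exact: smooth_on_grad.
Qed.

Lemma smooth_bracket f g : smooth_on U f -> smooth_on U g ->
  smooth_on U (bivector_bracket f g).
Proof.
by move=> sf sg; have /(smooth_on_mxP _ oU) := smooth_bracket_mx sf sg; apply.
Qed.

(** Leibniz rule on the three factors of the inner bracket: the derivative of [L] gives the Jacobi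
    term, those of the gradients give the Hessians. The minus sign comes from writing
    [(grad f)^T *m L] as [- (L *m grad f)^T]. *)
Lemma bracket2E f g k u : U u -> (L u)^T = - L u ->
  smooth_on U f -> smooth_on U g ->
  bivector_bracket (bivector_bracket f g) k u =
  (jacobi_term u (grad f u) (grad g u) (grad k u)
   + (L u *m grad k u)^T *m hessian f u *m (L u *m grad g u)
   - (L u *m grad f u)^T *m hessian g u *m (L u *m grad k u)) ord0 ord0.
Proof.
move=> Uu Lsk sf sg.
pose v := (L u *m grad k u)^T.
have dgrad (e : 'rV[R]_n -> R^o) : smooth_on U e -> differentiable (grad e) u.
  by move=> se; exact: smooth_on_differentiable (smooth_on_grad oU se) Uu.
have dLu : differentiable L u by exact: smooth_on_differentiable smoothL Uu.
have dfT : differentiable (fun t => (grad f t)^T) u.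
  apply: smooth_on_differentiable Uu; apply: smooth_on_trmx.
  exact: smooth_on_grad.
have dmx : differentiable (fun t => (grad f t)^T *m L t *m grad g t) u.
  exact: smooth_on_differentiable (smooth_bracket_mx sf sg) Uu.
(* Bracketing with [k] on the right is differentiation along [v]. *)
have -> : bivector_bracket (bivector_bracket f g) k u =
    'D_v (bivector_bracket f g) u.
  rewrite derive_grad; last first.
    exact: smooth_on_differentiable (smooth_bracket sf sg) Uu.
  rewrite -[in RHS](mx11_trmx (v *m _)) trmx_mul trmxK mulmxA.
  by [].
rewrite -(derive_mx_entry _ _ _ dmx) derive_mulmx//; last 2 first.
- exact: differentiable_mulmx.
- exact: dgrad.
rewrite derive_mulmx// derive_trmx; last exact: dgrad.
rewrite !(derive_gradE _ oU Uu)// !trmx_mul trmxK (hessian_sym oU Uu sf) trmxK.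
congr (fun_of_matrix _ ord0 ord0); rewrite mulmxDl /jacobi_term -/v.
rewrite [in X in X + _]addrC -!addrA; congr (_ + (_ + _)).
  by rewrite /v trmx_mul !mulmxA.
by rewrite Lsk !(mulmxN, mulNmx) opprK !mulmxA.
Qed.

Lemma jacobi_bracket f g k u : U u -> (L u)^T = - L u ->
  (forall a b c, jacobiator u a b c = 0) ->
  smooth_on U f -> smooth_on U g -> smooth_on U k ->
  bivector_bracket (bivector_bracket f g) k u +
  bivector_bracket (bivector_bracket g k) f u +
  bivector_bracket (bivector_bracket k f) g u = 0.
Proof.
move=> Uu Lsk J0 sf sg sk.
apply: etrans (congr2 +%R (congr2 +%R (bracket2E k Uu Lsk sf sg)
  (bracket2E f Uu Lsk sg sk)) (bracket2E g Uu Lsk sk sf)) _.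
(* [x], [y], [z] are the terms with the Hessians of [f], [g], [k]; each occurs once with either sign
   in the cyclic sum. *)
have alg (j1 j2 j3 x y z : 'M[R]_1) : j1 + j2 + j3 = 0 ->
    (j1 + x - y) ord0 ord0 + (j2 + y - z) ord0 ord0 + (j3 + z - x) ord0 ord0 = 0.
  by move=> /matrixP/(_ ord0 ord0); rewrite !mxE => <-; ring.
exact: alg (J0 (grad f u) (grad g u) (grad k u)).
Qed.

Hypothesis L_skew : forall u, U u -> (L u)^T = - L u.

Lemma derive_skew u v : U u -> ('D_v L u)^T = - 'D_v L u.
Proof.
move=> Uu; have dL := smooth_on_differentiable smoothL Uu.
rewrite -derive_trmx// -deriveN; last exact: diff_derivable.
apply: near_eq_derive; apply: eq_on_near oU _ Uu => t Ut.
by rewrite L_skew.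
Qed.

(** The hamiltonian field [{l, -}] of the linear function [l] with gradient [a]. *)
Definition const_comb a (t : 'rV[R]_n) : 'rV[R]_n := a^T *m L t.

Lemma derive_const_comb a u v : U u -> 'D_v (const_comb a) u = a^T *m 'D_v L u.
Proof.
move=> Uu; have dL := smooth_on_differentiable smoothL Uu.
rewrite (derive_mulmx _ (differentiable_cst a^T u) dL).
by rewrite derive_cst mul0mx add0r.
Qed.

(** By skewness [const_comb e u] is [-(L e)^T], so the two derivatives in the Lie bracket, paired
    with [c], are the other two Jacobi terms up to sign. On the right [c] occurs only through [L c]
    and in the pairing with the bracket. *)
Lemma jacobiatorE u a b c : U u ->
  jacobiator u a b c = jacobi_term u a b c -
    ('D_(const_comb a u) (const_comb b) u - 'D_(const_comb b u) (const_comb a) u) *m c.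
Proof.
move=> Uu; have dL := smooth_on_differentiable smoothL Uu.
have DLN v : 'D_(- v) L u = - 'D_v L u by rewrite !(deriveE _ dL) linearN.
have combE e : const_comb e u = - (L u *m e)^T.
  by rewrite trmx_mul L_skew// mulmxN opprK.
rewrite !(derive_const_comb _ _ Uu) !combE !DLN !mulmxN opprK.
rewrite -[X in _ = _ + X]mulNmx opprD opprK mulmxDl /jacobiator -addrA.
congr (_ + (_ + _)); rewrite /jacobi_term -[LHS]mx11_trmx !trmx_mul trmxK.
by rewrite derive_skew// !mulNmx mulmxN mulmxA.
Qed.

Lemma jacobiator_proj u (P : 'M[R]_n) : U u -> L u *m P = L u ->
  (forall a b, ('D_(const_comb a u) (const_comb b) u
      - 'D_(const_comb b u) (const_comb a) u) *m P =
    'D_(const_comb a u) (const_comb b) u - 'D_(const_comb b u) (const_comb a) u) ->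
  (forall a b c, jacobiator u (P *m a) (P *m b) (P *m c) = 0) ->
  forall a b c, jacobiator u a b c = 0.
Proof.
move=> Uu LP brP J0.
have JP a b c : jacobiator u a b c = jacobiator u a b (P *m c).
  by rewrite !jacobiatorE// /jacobi_term mulmxA LP [X in _ = _ - X]mulmxA brP.
have Jcyc a b c : jacobiator u a b c = jacobiator u b c a.
  by rewrite /jacobiator -addrA addrC.
(* Project the last slot and rotate, until all three slots are projected. *)
move=> a b c; rewrite JP Jcyc JP Jcyc JP; exact: J0.
Qed.

End LocalJacobi.

(** * Changes of charts *)

Lemma grad_comp (R : realType) (n m : nat) (g : 'rV[R]_m -> R^o)
    (phi : 'rV[R]_n -> 'rV[R]_m) (u : 'rV[R]_n) :
  differentiable phi u -> differentiable g (phi u) ->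
  grad (g \o phi) u = 'J phi u *m grad g (phi u).
Proof.
move=> dphi dg; have dgp := differentiable_comp dphi dg.
apply/matrixP => i j; rewrite ord1 mxE (deriveE _ dgp) diff_comp//=.
rewrite -(deriveE _ dphi) -(deriveE _ dg) (derive_grad _ dg).
by rewrite (deriveEjacobian _ dphi) -mulmxA -rowE mxE.
Qed.

Lemma near_eq_grad (R : realType) (n : nat) (f g : 'rV[R]_n -> R^o) u :
  {near u, f =1 g} -> grad f u = grad g u.
Proof.
by move=> fg; apply/matrixP => i j; rewrite !mxE; apply: near_eq_derive.
Qed.

Section Charts.
Context {R : realType} {p q : nat} {M : topologicalType}.
Implicit Types (c : chart R p q M) (x : M) (U : set M) (u : 'rV[R]_(p + q)).

Lemma cinvK c u : (c @` cdom c) u -> c (cinv c u) = u.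
Proof. by case=> y cy <-; rewrite cmapK. Qed.

Lemma cinv_dom c u : (c @` cdom c) u -> cdom c (cinv c u).
Proof. by case=> y cy <-; rewrite cmapK. Qed.

Lemma cimg_setI c U u : (c @` (U `&` cdom c)) u ->
  [/\ (c @` cdom c) u, U (cinv c u) & cdom c (cinv c u)].
Proof. by case=> y [Uy cy] <-; rewrite cmapK//; split=> //; exists y. Qed.

Lemma open_cimg c U : open U -> open (c @` (U `&` cdom c)).
Proof.
move=> oU; rewrite openE => u uU.
have [cu Uu _] := cimg_setI uU.
have HU : nbhs u (cinv c @^-1` U).
  by apply: cinv_continuous cu _ _; exact: open_nbhs_nbhs.
have Hc : nbhs u (c @` cdom c).
  by apply: open_nbhs_nbhs; split=> //; exact: cimg_open.
apply: filterS (filterI HU Hc) => v [Uv cv].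
by exists (cinv c v); [split=> //; exact: cinv_dom|exact: cinvK].
Qed.

Lemma mem_cimg_dom c x : cdom c x -> (c @` cdom c) (c x).
Proof. by move=> cx; exists x. Qed.

Lemma transitionE c c' x : cdom c x -> transition c c' (c x) = c' x.
Proof. by move=> cx; rewrite /transition/= cmapK. Qed.

End Charts.

(* Locked: otherwise unification unfolds jacobians when comparing two of them. *)
HB.lock Definition djac (R : realType) (p q : nat) (M : topologicalType)
  (c c' : chart R p q M) (u : 'rV[R]_(p + q)) : 'M[R]_(p + q) :=
  'J (transition c c') u.

Section FoliatedCharts.
Context {R : realType} {p q : nat} {M : foliatedManifold R p q}.
Local Notation atlas := (@fol_atlas R p q M).
Implicit Types (c : chart R p q M) (x : M) (U : set M) (u v w : 'rV[R]_(p + q)).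

Lemma smooth_transition c c' : atlas c -> atlas c' ->
  smooth_on (c @` (cdom c `&` cdom c')) (transition c c').
Proof. by move=> ac ac'; have [] := fol_compatible ac ac'. Qed.

Lemma open_overlap c c' : open (c @` (cdom c `&` cdom c')).
Proof. by rewrite setIC; apply: open_cimg; exact: cdom_open. Qed.

Lemma mem_overlap c c' x : cdom c x -> cdom c' x ->
  (c @` (cdom c `&` cdom c')) (c x).
Proof. by move=> cx c'x; exists x. Qed.

Lemma differentiable_transition c c' x : atlas c -> atlas c' ->
  cdom c x -> cdom c' x -> differentiable (transition c c') (c x).
Proof.
move=> ac ac' cx c'x.
exact: smooth_on_differentiable (smooth_transition ac ac') (mem_overlap cx c'x).
Qed.

(** Chain rule: [transition c c''] agrees with the composite through [c'] on the overlap of [c] and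
    [c'], which is open. *)
Lemma djac_cocycle c c' c'' x : atlas c -> atlas c' -> atlas c'' ->
  cdom c x -> cdom c' x -> cdom c'' x ->
  djac c c'' (c x) = djac c c' (c x) *m djac c' c'' (c' x).
Proof.
move=> ac ac' ac'' cx c'x c''x.
have d1 := differentiable_transition ac ac' cx c'x.
have d2 : differentiable (transition c' c'') (transition c c' (c x)).
  by rewrite transitionE//; exact: differentiable_transition.
rewrite djac.unlock -[in X in _ = _ *m X](transitionE c' cx).
apply: etrans _ (jacobian_comp d1 d2); apply: near_eq_jacobian.
  apply: (eq_on_near (@open_overlap c c')) (mem_overlap cx c'x) => v.
  move=> [y [cy c'y] <-]; rewrite /transition/= cmapK// cmapK//.
exact: differentiable_transition.
Qed.

Lemma djac_id c x : cdom c x -> djac c c (c x) = 1%:M.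
Proof.
move=> cx; have [dI JI] := @jacobian_linear R _ _ id 1%:M (c x)
  (fun v => esym (mulmx1 v)).
rewrite djac.unlock; apply: etrans _ JI; apply: esym; apply: near_eq_jacobian dI.
apply: (eq_on_near (@cimg_open _ _ _ _ c)) (mem_cimg_dom cx) => v cv.
by rewrite /transition/= cinvK.
Qed.

Lemma djacK c c' x : atlas c -> atlas c' -> cdom c x -> cdom c' x ->
  djac c c' (c x) *m djac c' c (c' x) = 1%:M.
Proof. by move=> *; rewrite -djac_cocycle// djac_id. Qed.

(* [v *m frame c x] are the components of the tangent vector v in the chart c,
   [coframe c x *m al] those of the covector al. *)
Definition frame c x : 'M[R]_(p + q) := djac (chart_at x) c (chart_at x x).
Definition coframe c x : 'M[R]_(p + q) := djac c (chart_at x) (c x).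

Lemma dmap_chart c x : dmap c x = frame c x.
Proof. by rewrite /frame djac.unlock. Qed.

Lemma frameK c x : atlas c -> cdom c x -> frame c x *m coframe c x = 1%:M.
Proof.
move=> ac cx; apply: djacK => //; [exact: chart_at_atlas|exact: chart_at_dom].
Qed.

Lemma coframeK c x : atlas c -> cdom c x -> coframe c x *m frame c x = 1%:M.
Proof.
move=> ac cx; apply: djacK => //; [exact: chart_at_atlas|exact: chart_at_dom].
Qed.

Lemma frame_chart_at x : frame (chart_at x) x = 1%:M.
Proof. by apply: djac_id; exact: chart_at_dom. Qed.

Lemma coframe_chart_at x : coframe (chart_at x) x = 1%:M.
Proof. by apply: djac_id; exact: chart_at_dom. Qed.

Lemma vrepE c (X : M -> 'rV[R]_(p + q)) x : cdom c x ->
  vrep c X (c x) = X x *m frame c x.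
Proof. by move=> cx; rewrite /vrep cmapK// dmap_chart. Qed.

Lemma crepE c (a : M -> 'cV[R]_(p + q)) x : cdom c x ->
  crep c a (c x) = coframe c x *m a x.
Proof. by move=> cx; rewrite /crep cmapK// /coframe djac.unlock. Qed.

Lemma frame_change c c' x : atlas c -> atlas c' -> cdom c x -> cdom c' x ->
  frame c' x = frame c x *m djac c c' (c x).
Proof.
move=> ac ac' cx c'x; apply: djac_cocycle => //.
  exact: chart_at_atlas.
exact: chart_at_dom.
Qed.

Lemma coframe_change c c' x : atlas c -> atlas c' -> cdom c x -> cdom c' x ->
  coframe c' x = djac c' c (c' x) *m coframe c x.
Proof.
move=> ac ac' cx c'x; apply: djac_cocycle => //.
  exact: chart_at_atlas.
exact: chart_at_dom.
Qed.

(** Reduces smoothness to a single chart containing [U]: the expression in another chart is obtained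
    by composing with the transition and multiplying by its Jacobian, both smooth. *)
Lemma smooth_vfield_chart c U X : atlas c -> open U -> U `<=` cdom c ->
  smooth_on (c @` U) (vrep c X) -> smooth_vfield U X.
Proof.
move=> ac oU Uc sX c' ac'.
have oU' := @open_cimg _ _ _ _ c' U oU.
have E (v : 'rV[R]_(p + q)) : (c' @` (U `&` cdom c')) v ->
    vrep c X (transition c' c v) *m djac c c' (transition c' c v) = vrep c' X v.
  move=> [y [Uy c'y] <-]; rewrite transitionE//.
  have cy := Uc _ Uy.
  by rewrite (vrepE _ cy) (vrepE _ c'y) (frame_change ac ac' cy c'y) mulmxA.
apply: (eq_smooth_on oU' E).
have sub v : (c' @` (U `&` cdom c')) v -> (c @` U) (transition c' c v).
  by move=> [y [Uy c'y] <-]; rewrite transitionE//; exists y.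
have oV : open (c @` U).
  by rewrite -(setIidl Uc); exact: open_cimg.
have str : smooth_on (c' @` (U `&` cdom c')) (transition c' c).
  apply: smooth_on_sub (smooth_transition ac' ac) => _ [y [Uy c'y] <-].
  by exists y => //; split=> //; exact: Uc.
apply: (smooth_on_mulmx oU').
  exact: (smooth_on_comp oU' oV sub sX str).
apply: (smooth_on_comp (f := fun u => djac c c' u) oU' (@open_overlap c c')) str.
  by move=> _ [y [Uy c'y] <-]; rewrite transitionE//; exists y => //; split=> //;
    exact: Uc.
by rewrite djac.unlock; apply: smooth_on_jacobian;
  [exact: open_overlap|exact: smooth_transition].
Qed.

Lemma smooth_form_chart c U a : atlas c -> open U -> U `<=` cdom c ->
  smooth_on (c @` U) (crep c a) -> smooth_form U a.
Proof.
move=> ac oU Uc sa c' ac'.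
have oU' := @open_cimg _ _ _ _ c' U oU.
have E (v : 'rV[R]_(p + q)) : (c' @` (U `&` cdom c')) v ->
    djac c' c v *m crep c a (transition c' c v) = crep c' a v.
  move=> [y [Uy c'y] <-]; rewrite transitionE//.
  have cy := Uc _ Uy.
  by rewrite (crepE _ cy) (crepE _ c'y) (coframe_change ac ac' cy c'y) mulmxA.
apply: (eq_smooth_on oU' E).
have sub v : (c' @` (U `&` cdom c')) v -> (c @` U) (transition c' c v).
  by move=> [y [Uy c'y] <-]; rewrite transitionE//; exists y.
have oV : open (c @` U).
  by rewrite -(setIidl Uc); exact: open_cimg.
have str : smooth_on (c' @` (U `&` cdom c')) (transition c' c).
  apply: smooth_on_sub (smooth_transition ac' ac) => _ [y [Uy c'y] <-].
  by exists y => //; split=> //; exact: Uc.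
apply: (smooth_on_mulmx oU').
  by rewrite djac.unlock; exact: smooth_on_jacobian str.
exact: (smooth_on_comp oU' oV sub sa str).
Qed.

Lemma dfun_chart c (f : M -> R) x : atlas c -> cdom c x ->
  differentiable (f \o cinv c : _ -> R^o) (c x) ->
  dfun f x = frame c x *m grad (f \o cinv c) (c x).
Proof.
move=> ac cx df; have cxx := chart_at_dom x.
have df' : differentiable (f \o cinv c : _ -> R^o)
    (transition (chart_at x) c (chart_at x x)) by rewrite transitionE.
have dtr := differentiable_transition (chart_at_atlas x) ac cxx cx.
apply: etrans (_ : grad (f \o cinv (chart_at x)) (chart_at x x) = _) _ => //.
rewrite -[in RHS](transitionE c cxx) /frame djac.unlock.
apply: etrans _ (grad_comp dtr df'); apply: near_eq_grad.
apply: (eq_on_near (@open_overlap (chart_at x) c)) (mem_overlap cxx cx) => v.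
by move=> [y [cy c'y] <-]; rewrite /transition/= !cmapK.
Qed.

End FoliatedCharts.

(** * Leaf directions in foliated charts *)

Section Vertical.
Context {R : realType} {p q : nat} {M : foliatedManifold R p q}.
Local Notation atlas := (@fol_atlas R p q M).
Implicit Types (c : chart R p q M) (x : M) (U : set M) (u v w : 'rV[R]_(p + q)).

(** The matrix of [rsubmx]: [w *m trans_mx = 0] says that the coordinate vector [w] points along the
    leaves. *)
Definition trans_mx : 'M[R]_(p + q, q) := col_mx 0 1%:M.

Lemma mul_trans_mx m (A : 'M[R]_(m, p + q)) : A *m trans_mx = rsubmx A.
Proof.
by rewrite -[in LHS](hsubmxK A) mul_row_col mulmx0 add0r mulmx1.
Qed.

(** Testing on the first [p] basis vectors, which are leaf directions, kills the upper block of
    [a]. *)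
Lemma trans_mxK m (a : 'M[R]_(p + q, m)) :
  (forall w, w *m trans_mx = 0 -> w *m a = 0) -> a = trans_mx *m dsubmx a.
Proof.
move=> H; rewrite /trans_mx mul_col_mx mul0mx mul1mx -[LHS]vsubmxK.
congr (col_mx _ _); apply/row_matrixP => i; rewrite row0 rowE.
have := H (row_mx (delta_mx ord0 i) 0).
rewrite mul_trans_mx row_mxKr => /(_ erefl).
by rewrite -[X in _ *m X = 0](vsubmxK a) mul_row_col mul0mx addr0.
Qed.

(** The transverse part of a foliated transition depends locally on the transverse coordinates
    alone, so its difference quotient in a leaf direction vanishes for small increments. *)
Lemma djac_vertical c c' x w : atlas c -> atlas c' -> cdom c x -> cdom c' x ->
  w *m trans_mx = 0 -> w *m djac c c' (c x) *m trans_mx = 0.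
Proof.
move=> ac ac' cx c'x w0; have dtr := differentiable_transition ac ac' cx c'x.
have [N nN HN] := (fol_compatible ac ac').2 _ (mem_overlap cx c'x).
rewrite djac.unlock -(deriveEjacobian w dtr).
have dm := derive_mulmx w dtr (differentiable_cst trans_mx (c x)).
rewrite derive_cst mulmx0 addr0 in dm; rewrite -dm.
apply: cvg_lim => //; apply: cvg_near_cst; rewrite /= !mul_trans_mx.
have cl : {for 0, continuous (fun h : R => h *: w + c x)}.
  apply: (@continuousD _ _ _ (fun h : R => h *: w) (fun=> c x)).
    exact: scalel_continuous.
  exact: cst_continuous.
have N0 : nbhs (0 *: w + c x) N by rewrite scale0r add0r.
apply: nbhs_dnbhs; have clN : \forall h \near (0 : R), N (h *: w + c x) := cl _ N0.
apply: filterS clN => h /= Nh; rewrite mul_trans_mx.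
rewrite (HN _ (c x) Nh (nbhs_singleton nN)); first by rewrite subrr scaler0.
rewrite -!mul_trans_mx mulmxDl -scalemxAl w0 scaler0 add0r//.
Qed.

Lemma dmap_transverse c x : atlas c -> cdom c x ->
  dmap (rsubmx \o c : M -> 'rV[R]_q) x = frame c x *m trans_mx.
Proof.
move=> ac cx; have cxx := chart_at_dom x.
have dtr := differentiable_transition (chart_at_atlas x) ac cxx cx.
have [dr Jr] := @jacobian_linear R _ _ rsubmx trans_mx
  (transition (chart_at x) c (chart_at x x)) (fun v => esym (mul_trans_mx v)).
rewrite /frame djac.unlock -Jr; exact: jacobian_comp dtr dr.
Qed.

(** [TF x] is defined through [chart_at x]; [djac_vertical], applied to the transition and to its
    inverse, carries the description to any chart around [x]. *)
Lemma TF_frame c x v : atlas c -> cdom c x ->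
  (v <= TF x)%MS <-> v *m frame c x *m trans_mx = 0.
Proof.
move=> ac cx; have cxx := chart_at_dom x; have acx := chart_at_atlas x.
have -> : (v <= TF x)%MS = (v *m trans_mx == 0).
  by rewrite /TF dmap_transverse// frame_chart_at mul1mx sub_kermx.
split=> [/eqP v0|v0]; first exact: djac_vertical.
apply/eqP; rewrite -[v]mulmx1 -(frameK ac cx) mulmxA; exact: djac_vertical.
Qed.

End Vertical.

(** * The bivector field of a hamiltonian structure *)

Section Bivector.
Context {R : realType} {p q : nat} {M : foliatedManifold R p q}.
Context (h : M -> 'cV[R]_(p + q) -> 'rV[R]_(p + q)) (E : M -> 'M[R]_(p + q)).
Hypothesis ham : hamiltonian_structure h.
Hypothesis ext : image_extension h E.
Local Notation atlas := (@fol_atlas R p q M).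
Implicit Types (c : chart R p q M) (x : M) (U : set M) (u v w : 'rV[R]_(p + q)).
Implicit Types (al be : 'cV[R]_(p + q)).

Lemma conormalP x al :
  conormal x al <-> forall v, (v <= TF x)%MS -> v *m al = 0.
Proof.
split=> H v vT; last by rewrite /pairing H// mxE.
by apply/matrixP => i j; rewrite !ord1 [RHS]mxE; exact: H.
Qed.

Lemma conormal_comb x r al be :
  conormal x al -> conormal x be -> conormal x (r *: al + be).
Proof.
move=> /conormalP a0 /conormalP b0; apply/conormalP => v vT.
by rewrite mulmxDr -scalemxAr a0// b0// scaler0 addr0.
Qed.

Lemma conormal0 x : conormal x 0.
Proof. by apply/conormalP => v _; rewrite mulmx0. Qed.

Lemma conormal_projE x al : conormal x (projE E x *m al).
Proof.
apply/conormalP => v vT; rewrite mulmxA /projE proj_mx_0 ?mul0mx//.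
exact: ext_disjoint ext x.
Qed.

(** For every [v] the vector [v - v *m projE E x] lies in [TF x], where [al] vanishes. *)
Lemma projE_conormal x al : conormal x al -> projE E x *m al = al.
Proof.
move=> /conormalP a0; apply/row_matrixP => i; apply/eqP; rewrite !rowE mulmxA eq_sym.
rewrite -subr_eq0 -mulmxBl a0//; apply: proj_mx_compl_sub.
by rewrite (ext_full ext x) submx1.
Qed.

Lemma projE_image x al : conormal x al -> h x al *m projE E x = h x al.
Proof.
move=> ca; apply: proj_mx_id; first exact: ext_disjoint ext x.
by apply: (ext_image ext); exists al.
Qed.

Lemma h0 x : h x 0 = 0.
Proof.
have [hl _] := ham_morphism ham.
have := hl x 1 0 0 (@conormal0 x) (@conormal0 x).
by rewrite scaler0 addr0 scale1r => /eqP; rewrite -subr_eq0 opprD addNKr oppr_eq0 => /eqP.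
Qed.

(** [h x] is linear on conormal covectors only, so conormality of the partial sums is carried
    through the induction. *)
Lemma h_sum x (I : finType) (r : I -> R) (al : I -> 'cV[R]_(p + q)) :
  (forall i, conormal x (al i)) ->
  h x (\sum_i r i *: al i) = \sum_i r i *: h x (al i).
Proof.
have [hl _] := ham_morphism ham; move=> ca.
suff [_ ->] : conormal x (\sum_i r i *: al i) /\
  h x (\sum_i r i *: al i) = \sum_i r i *: h x (al i) by [].
apply: (big_ind2 (fun a b => conormal x a /\ h x a = b)).
- by split; [exact: conormal0|exact: h0].
- move=> a b a' b' [ca1 <-] [ca2 <-]; rewrite -[a]scale1r; split.
    exact: conormal_comb.
  by rewrite hl// !scale1r.
- move=> i _; rewrite -[r i *: al i]addr0; split.
    by apply: conormal_comb => //; exact: conormal0.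
  by rewrite hl ?h0 ?addr0//; exact: conormal0.
Qed.

(* The vector h(p_E^* a), for a covector with components a in the chart c. *)
Definition hvec c x (a : 'cV[R]_(p + q)) : 'rV[R]_(p + q) :=
  h x (projE E x *m (frame c x *m a)).

(** Row [i] is the field [H(d'x^i)] in the coordinates of [c], so the entries are the brackets
    [{x^i, x^j}']. *)
Definition bivec c x : 'M[R]_(p + q) :=
  \matrix_i (hvec c x (delta_mx i ord0) *m frame c x).

(* The matrix of p_E in the chart c, acting on row vectors on the right. *)
Definition projc c x : 'M[R]_(p + q) := coframe c x *m projE E x *m frame c x.

Lemma hvecE c x a : hvec c x a *m frame c x = a^T *m bivec c x.
Proof.
have -> : hvec c x a = \sum_i a i ord0 *: hvec c x (delta_mx i ord0).
  rewrite -h_sum => [|i]; last exact: conormal_projE.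
  congr (h x _); rewrite [in LHS](matrix_sum_delta a) !mulmx_sumr.
  by apply: eq_bigr => i _; rewrite big_ord1 -!scalemxAr.
rewrite mulmx_suml mulmx_sum_row; apply: eq_bigr => i _.
by rewrite -scalemxAl rowK mxE.
Qed.

Lemma hvec_conormal c x al : atlas c -> cdom c x -> conormal x al ->
  h x al = (coframe c x *m al)^T *m bivec c x *m coframe c x.
Proof.
move=> ac cx ca.
by rewrite -hvecE /hvec (mulmxA (frame c x)) frameK// mul1mx projE_conormal//
  -mulmxA frameK// mulmx1.
Qed.

Lemma hvec_projE c x a : hvec c x a *m projE E x = hvec c x a.
Proof. by apply: projE_image; exact: conormal_projE. Qed.

Lemma bivecE c x a (b : 'cV[R]_(p + q)) :
  a^T *m bivec c x *m b = hvec c x a *m (frame c x *m b).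
Proof. by rewrite -hvecE mulmxA. Qed.

(** As [im h] lies in [E], the covector in the second slot may be replaced by its conormal part;
    then skewness of [h] applies. *)
Lemma bivec_skew c x : (bivec c x)^T = - bivec c x.
Proof.
have E1 i j : bivec c x i j =
    pairing (projE E x *m (frame c x *m delta_mx j ord0)) (hvec c x (delta_mx i ord0)).
  rewrite /pairing mulmxA hvec_projE.
  by rewrite mulmxA -colE [RHS]mxE [LHS]mxE.
apply/matrixP => i j; rewrite [LHS]mxE [RHS]mxE !E1.
by apply: (ham_skew ham); exact: conormal_projE.
Qed.

Lemma bivec_proj c x : atlas c -> cdom c x -> bivec c x *m projc c x = bivec c x.
Proof.
move=> ac cx; apply/row_matrixP => i; rewrite row_mul rowK /projc.
rewrite -(mulmxA (coframe c x)) (mulmxA (_ *m frame c x)).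
by rewrite -(mulmxA (hvec c x _)) frameK// mulmx1 mulmxA hvec_projE.
Qed.

Lemma vertical_projc c x w : atlas c -> cdom c x ->
  w *m trans_mx = 0 -> w *m projc c x = 0.
Proof.
move=> ac cx w0; rewrite /projc -mulmxA (mulmxA w) mulmxA /projE.
rewrite proj_mx_0 ?mul0mx//; first exact: ext_disjoint ext x.
by apply/(TF_frame _ ac cx); rewrite -(mulmxA w) coframeK// mulmx1.
Qed.

Lemma projc_trans c x (a : 'cV[R]_(p + q)) w : atlas c -> cdom c x ->
  w *m trans_mx = 0 -> w *m (projc c x *m a) = 0.
Proof. by move=> ac cx w0; rewrite mulmxA vertical_projc// mul0mx. Qed.

Lemma conormal_frame c x (a : 'cV[R]_(p + q)) : atlas c -> cdom c x ->
  (forall w, w *m trans_mx = 0 -> w *m a = 0) -> conormal x (frame c x *m a).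
Proof.
move=> ac cx a0; apply/conormalP => v /(TF_frame _ ac cx) v0.
by rewrite mulmxA; exact: a0.
Qed.

Lemma bracket_bivec c (f g : M -> R) x : atlas c -> cdom c x ->
  differentiable (f \o cinv c : _ -> R^o) (c x) ->
  differentiable (g \o cinv c : _ -> R^o) (c x) ->
  bracket' h E f g x =
  bivector_bracket (bivec c \o cinv c) (f \o cinv c) (g \o cinv c) (c x).
Proof.
move=> ac cx df dg; rewrite /bracket' /Hmap /dprime (dfun_chart ac cx df).
rewrite (dfun_chart ac cx dg) /pairing /bivector_bracket bivecE/=.
by rewrite cmapK.
Qed.

End Bivector.

(** * Smoothness of the projection and of the bivector field *)

(** Here [X] generates [E], and [F] is the kernel of [V] in the coordinates [T]. The right-hand side
    [G] kills [F], takes values in [E] and satisfies [G V = V], which characterizes the projection;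
    being rational in [X T], it is visibly smooth in a family. *)
Lemma complement_projection (R : fieldType) (n m q : nat) (E F T T' : 'M[R]_n)
    (X : 'M[R]_(m, n)) (V : 'M[R]_(n, q)) (A : 'M[R]_(q, m)) :
  (E :&: F)%MS = 0 -> (E + F :=: 1%:M)%MS -> (E :=: X)%MS ->
  T *m T' = 1%:M -> T' *m T = 1%:M ->
  (forall v : 'rV_n, (v <= F)%MS <-> v *m T *m V = 0) ->
  A *m (X *m T *m V) \in unitmx ->
  T' *m proj_mx E F *m T =
    V *m invmx (A *m (X *m T *m V)) *m (A *m (X *m T)).
Proof.
move=> EF0 EF1 EX TT' T'T FV Au.
have PF (v : 'rV_n) : (v <= F)%MS -> v *m proj_mx E F = 0 by apply: proj_mx_0.
have PE (v : 'rV_n) : (v <= E)%MS -> v *m proj_mx E F = v by apply: proj_mx_id.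
move: (proj_mx E F) PF PE => P PF PE.
set B := A *m _ in Au *; set G := V *m _ *m _.
have GV : G *m V = V.
  by rewrite /G -(mulmxA _ _ V) -(mulmxA A) -/B -mulmxA mulVmx// mulmx1.
have FG (f : 'rV_n) : (f <= F)%MS -> f *m T *m G = 0.
  by move=> fF; rewrite /G !mulmxA (proj1 (FV _) fF) !mul0mx.
have GT' : (T *m G *m T' <= E)%MS.
  rewrite EX /G (mulmxA A) (mulmxA _ (A *m X)) (mulmxA T).
  by rewrite -(mulmxA _ T) TT' mulmx1 (mulmxA _ A) (mulmxA T) submxMl.
clearbody G.
suff H : P *m T = T *m G by rewrite -mulmxA H mulmxA T'T mul1mx.
apply/row_matrixP => i; rewrite !rowE !mulmxA; move: (delta_mx _ _) => v.
have : (v <= E + F)%MS by rewrite EF1 submx1.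
move=> /sub_addsmxP[[a b] /= ->].
have bF : (b *m F <= F)%MS by exact: submxMl.
have aE : (a *m E <= E)%MS by exact: submxMl.
move: (a *m E) (b *m F) aE bF => e f eE fF.
rewrite !mulmxDl (FG _ fF) addr0 (PF _ fF) mul0mx addr0 (PE _ eE).
(* [e] and its image both lie in [E] and have the same transverse part, so their difference lies in
   [E] and in [F]. *)
suff : (e - e *m (T *m G *m T') <= E :&: F)%MS.
  rewrite EF0 submx0 subr_eq0 => /eqP E1; rewrite [in LHS]E1.
  by rewrite -!mulmxA T'T mulmx1.
have eGE : (e *m (T *m G *m T') <= E)%MS.
  exact: submx_trans (submxMl _ _) GT'.
rewrite sub_capmx addmx_sub ?eqmx_opp//=.
apply/FV; rewrite !mulmxBl; apply/eqP; rewrite subr_eq0; apply/eqP.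
have -> : e *m (T *m G *m T') *m T *m V = e *m T *m (G *m V).
  by rewrite -!mulmxA (mulmxA T' T) T'T mul1mx.
by rewrite GV.
Qed.

Section SmoothBivector.
Context {R : realType} {p q : nat} {M : foliatedManifold R p q}.
Context (h : M -> 'cV[R]_(p + q) -> 'rV[R]_(p + q)) (E : M -> 'M[R]_(p + q)).
Hypothesis ham : hamiltonian_structure h.
Hypothesis ext : image_extension h E.
Local Notation atlas := (@fol_atlas R p q M).
Implicit Types (c : chart R p q M) (x : M) (U : set M) (u v w : 'rV[R]_(p + q)).

(** [E] is a complement of the leaf directions, so the transverse parts of its generators span
    [R^q]; the rows of [A] are the coefficients producing the standard basis. *)
Lemma transverse_full c x m (X : 'M[R]_(m, p + q)) : atlas c -> cdom c x ->
  (E x :=: X)%MS -> exists A : 'M[R]_(q, m), A *m (X *m frame c x *m trans_mx) = 1%:M.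
Proof.
move=> ac cx EX; apply/row_fullP; rewrite -sub1mx; apply/row_subP => i.
set z := row i 1%:M.
(* Lift the basis vector [z] to a tangent vector and split it along [E] and [TF]; the leaf part has
   no transverse component. *)
have : (z *m trans_mx^T *m coframe c x <= E x + TF x)%MS.
  by rewrite (ext_full ext x) submx1.
move=> /sub_addsmxP[[a b] /= zE].
have : (a *m E x <= X)%MS by rewrite -EX submxMl.
move=> /submxP[w aw]; rewrite aw in zE; apply/submxP; exists w.
have bT : b *m TF x *m frame c x *m trans_mx = 0.
  by apply/(TF_frame _ ac cx); exact: submxMl.
have tt : (trans_mx : 'M[R]_(p + q, q))^T *m (trans_mx : 'M[R]_(p + q, q)) = 1%:M.
  by rewrite mul_trans_mx tr_col_mx row_mxKr trmx1.
rewrite !mulmxA -[RHS]addr0 -bT -!mulmxDl -zE.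
by rewrite -(mulmxA _ (coframe c x)) coframeK// mulmx1 -mulmxA tt mulmx1.
Qed.

Lemma smooth_projc c : atlas c ->
  smooth_on (c @` cdom c) (projc E c \o cinv c).
Proof.
move=> ac; apply: smooth_on_bigcup => u cu.
have cx := cinv_dom cu; have [N [m [X [[oN Nx] sX EX]]]] := ext_smooth ext (cinv c u).
pose XX v := \matrix_(i < m) vrep c (X i) v.
have oV := @open_cimg _ _ _ _ c N oN; set V := c @` (N `&` cdom c) in oV.
have Vu : V u by exists (cinv c u) => //; exact: cinvK.
have sXX : smooth_on V XX.
  apply/smooth_on_mxP => // i j.
  have /(smooth_on_mxP _ oV)/(_ ord0 j) := sX i c ac.
  apply: eq_smooth_on oV _ => v _.
  by rewrite /XX mxE.
have XXE v : V v -> XX v =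
    (\matrix_(i < m) X i (cinv c v)) *m frame c (cinv c v).
  move=> /cimg_setI[cv _ cy]; apply/row_matrixP => i; rewrite row_mul !rowK.
  by have := vrepE (X i) cy; rewrite (cinvK cv).
(* [A] is chosen at the point [u] and then kept constant; by continuity of the determinant
   [A *m (XX v *m trans_mx)] stays invertible for [v] near [u]. *)
have [A A1] := transverse_full ac cx (EX _ Nx).
pose B v := A *m (XX v *m trans_mx).
have sB : smooth_on V B.
  apply: (smooth_on_mulmx oV); first exact: smooth_on_cst.
  by apply: (smooth_on_mulmx oV) => //; exact: smooth_on_cst.
have dB := smooth_on_det oV sB.
have HB : nbhs u [set v | V v /\ \det (B v) != 0].
  apply: filterI; first exact: open_nbhs_nbhs.
  have cB := smooth_on_continuous dB Vu.
  have H0 : nbhs (\det (B u) : R^o) [set r : R^o | r != 0].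
    apply: open_nbhs_nbhs; split; first exact: open_neq.
    by rewrite /= /B XXE// A1 det1 oner_neq0.
  exact: cB _ H0.
move: HB; rewrite nbhsE => -[W [oW Wu] WV].
exists W => //.
have WsV : W `<=` V by move=> v /WV[].
have Bu v : W v -> B v \in unitmx by move=> /WV[_]; rewrite unitmxE unitfE.
have sBi := smooth_on_invmx oW Bu (smooth_on_sub WsV sB).
have sAX := smooth_on_mulmx oW (smooth_on_cst W A) (smooth_on_sub WsV sXX).
have st := smooth_on_cst W (trans_mx : 'M[R]_(p + q, q)).
have sG := smooth_on_mulmx oW (smooth_on_mulmx oW st sBi) sAX.
apply: eq_smooth_on oW _ sG => v Wv.
have [Vv Bv] := WV _ Wv; have [cv Nv cy] := cimg_setI Vv.
rewrite /comp /projc /projE /B XXE//; apply: esym; apply: complement_projection.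
- exact: ext_disjoint ext _.
- exact: ext_full ext _.
- exact: EX.
- exact: frameK.
- exact: coframeK.
- by move=> w; exact: TF_frame.
- by rewrite -XXE// unitmxE unitfE.
Qed.

(** The field is the image under [h] of the conormal form [p_E^* a], which is smooth because the
    projection is. *)
Lemma smooth_hvec c a : atlas c -> smooth_vfield (cdom c) (hvec h E c ^~ a).
Proof.
move=> ac; have [_ Hs] := ham_morphism ham.
apply: (Hs _ (fun x => projE E x *m (frame c x *m a)) (@cdom_open _ _ _ _ c)); split.
  apply: (smooth_form_chart ac (@cdom_open _ _ _ _ c)) => //.
  have oc := @cimg_open _ _ _ _ c.
  have sp := smooth_on_mulmx oc (smooth_projc ac) (smooth_on_cst _ a).
  apply: eq_smooth_on oc _ sp => u cu.
  have := crepE (fun x => projE E x *m (frame c x *m a)) (cinv_dom cu).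
  by rewrite (cinvK cu) => ->; rewrite /= /projc -!mulmxA.
by move=> x _; exact: (conormal_projE ext).
Qed.

Lemma vrep_hvec c a u : (c @` cdom c) u ->
  vrep c (hvec h E c ^~ a) u = const_comb (bivec h E c \o cinv c) a u.
Proof.
move=> cu; have := vrepE (hvec h E c ^~ a) (cinv_dom cu).
by rewrite (cinvK cu) => ->; rewrite (hvecE ham ext).
Qed.

Lemma smooth_bivec c : atlas c ->
  smooth_on (c @` cdom c) (bivec h E c \o cinv c).
Proof.
move=> ac; have oc := @cimg_open _ _ _ _ c; apply/smooth_on_mxP => // i j.
have := smooth_hvec (delta_mx i ord0) ac ac; rewrite setIid.
move=> /(smooth_on_mxP _ oc)/(_ ord0 j); apply: eq_smooth_on => // u cu.
by rewrite vrep_hvec// /const_comb trmx_delta -rowE mxE.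
Qed.

End SmoothBivector.

(** * Vanishing of the jacobiator *)

Section Jacobi.
Context {R : realType} {p q : nat} {M : foliatedManifold R p q}.
Context (h : M -> 'cV[R]_(p + q) -> 'rV[R]_(p + q)) (E : M -> 'M[R]_(p + q)).
Hypothesis ham : hamiltonian_structure h.
Hypothesis ext : image_extension h E.
Local Notation atlas := (@fol_atlas R p q M).
Implicit Types (c : chart R p q M) (x : M) (U : set M) (u v w : 'rV[R]_(p + q)).
Implicit Types (a b g : 'cV[R]_(p + q)).

Local Notation bivf c := (bivec h E c \o cinv c).

Lemma vrep_near c (X : M -> 'rV[R]_(p + q)) a x : cdom c x ->
  (forall y, cdom c y -> X y = hvec h E c y a) ->
  {near c x, vrep c X =1 const_comb (bivf c) a}.
Proof.
move=> cx XE; apply: (eq_on_near (@cimg_open _ _ _ _ c)) (mem_cimg_dom cx) => u cu.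
by rewrite -(vrep_hvec ham ext)// /vrep XE//; exact: cinv_dom.
Qed.

Lemma lie_bracket_hvec x a b (c := chart_at x) :
  lie_bracket (hvec h E c ^~ a) (hvec h E c ^~ b) x =
  'D_(const_comb (bivf c) a (c x)) (const_comb (bivf c) b) (c x) -
  'D_(const_comb (bivf c) b (c x)) (const_comb (bivf c) a) (c x).
Proof.
have cx := chart_at_dom x; have cu := mem_cimg_dom cx.
have Na e := @vrep_near c (hvec h E c ^~ e) e x cx (fun _ _ => erefl).
rewrite /lie_bracket -/c.
rewrite (vrep_hvec ham ext a cu) (vrep_hvec ham ext b cu).
exact: (congr2 (fun X Y => X - Y) (near_eq_derive _ (Na b)) (near_eq_derive _ (Na a))).
Qed.

(** Both fields take values in [im h], so tameness puts their bracket in [E]; at [x] the frames of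
    [chart_at x] are the identity and [projc] is [projE]. *)
Lemma tame_bracket x a b (c := chart_at x) :
  lie_bracket (hvec h E c ^~ a) (hvec h E c ^~ b) x *m projc E c x =
  lie_bracket (hvec h E c ^~ a) (hvec h E c ^~ b) x.
Proof.
have ac := chart_at_atlas x; have cx := chart_at_dom x.
have im e y : in_image h y (hvec h E c y e).
  by exists (projE E y *m (frame c y *m e)) => //; exact: (conormal_projE ext).
rewrite /projc frame_chart_at coframe_chart_at mul1mx mulmx1.
apply: proj_mx_id; first exact: ext_disjoint ext x.
exact: (ext_bracket ext (@cdom_open _ _ _ _ c) (smooth_hvec ham ext a ac)
  (fun y _ => im a y) (smooth_hvec ham ext b ac) (fun y _ => im b y) cx).
Qed.

(* The constant coefficient form [a_i dx^i] of the chart [c]. *)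
Definition chart_form c a : M -> 'cV[R]_(p + q) := fun y => frame c y *m a.

(** As [a] has no leaf components, the form is the pullback of the constant form [dsubmx a] on
    [R^q]. *)
Lemma projectable_chart_form c a : atlas c ->
  (forall w, w *m trans_mx = 0 -> w *m a = 0) ->
  projectable_form (cdom c) (chart_form c a).
Proof.
move=> ac a0; have oc := @cdom_open _ _ _ _ c; split; first split.
- apply: (smooth_form_chart ac oc) => //.
  apply: eq_smooth_on (@cimg_open _ _ _ _ c) _ (smooth_on_cst _ a) => u cu.
  have := crepE (chart_form c a) (cinv_dom cu); rewrite (cinvK cu) => ->.
  by rewrite /chart_form mulmxA coframeK ?mul1mx//; exact: cinv_dom.
- by move=> y cy; exact: conormal_frame.
- move=> x cx; exists c, (cdom c), (fun=> dsubmx a); split=> //.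
  + exact: smooth_on_cst.
  + by move=> y cy; rewrite dmap_transverse// -mulmxA -trans_mxK.
Qed.

Lemma Hmap_chart_form c a y : atlas c -> cdom c y ->
  (forall w, w *m trans_mx = 0 -> w *m a = 0) ->
  Hmap h (chart_form c a) y = hvec h E c y a.
Proof.
move=> ac cy a0; rewrite /hvec (projE_conormal ext)//.
exact: conormal_frame.
Qed.

(** Constant leaf fields of a chart, the test fields for the foliated condition. *)
Lemma tangent_coordinate c w : atlas c -> w *m trans_mx = 0 ->
  tangent_vfield (cdom c) (fun y : M => w *m coframe c y).
Proof.
move=> ac w0; split.
  apply: (smooth_vfield_chart ac (@cdom_open _ _ _ _ c)) => //.
  apply: eq_smooth_on (@cimg_open _ _ _ _ c) _ (smooth_on_cst _ w) => u cu.
  have := vrepE (fun y => w *m coframe c y) (cinv_dom cu); rewrite (cinvK cu) => ->.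
  by rewrite -mulmxA coframeK ?mulmx1//; exact: cinv_dom.
by move=> y cy; apply/(TF_frame _ ac cy); rewrite -(mulmxA w) coframeK// mulmx1.
Qed.

(** The bracket of a field [X] with the constant leaf field [w] is [-'D_w X] in the chart; as [H]
    sends projectable forms to foliated fields, its transverse part vanishes. *)
Lemma foliated_const_comb x a w (c := chart_at x) :
  (forall w, w *m trans_mx = 0 -> w *m a = 0) -> w *m trans_mx = 0 ->
  'D_w (const_comb (bivf c) a) (c x) *m trans_mx = 0.
Proof.
move=> a0 w0; have ac := chart_at_atlas x; have cx := chart_at_dom x.
have cu := mem_cimg_dom cx.
have [_ fol] := ham_foliated ham (@cdom_open _ _ _ _ c) (projectable_chart_form ac a0).
have /(TF_frame _ ac cx) := fol _ (tangent_coordinate ac w0) x cx.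
rewrite frame_chart_at mulmx1 /lie_bracket -/c.
set Y := fun y => w *m coframe c y.
have Yc : {near c x, vrep c Y =1 fun=> w}.
  apply: (eq_on_near (@cimg_open _ _ _ _ c)) cu => u uc.
  have := vrepE Y (cinv_dom uc); rewrite (cinvK uc) => ->.
  by rewrite /Y -mulmxA coframeK ?mulmx1//; exact: cinv_dom.
have Xc : {near c x, vrep c (Hmap h (chart_form c a)) =1 const_comb (bivf c) a}.
  by apply: vrep_near => // y cy; exact: Hmap_chart_form.
rewrite (nbhs_singleton Yc) (near_eq_derive _ Yc) derive_cst sub0r.
by rewrite (near_eq_derive w Xc) mulNmx => /eqP; rewrite oppr_eq0 => /eqP.
Qed.

(** With [b] constant, the Lie derivative reduces to [J b], where [J] is the Jacobian of
    [const_comb a]. Pairing [h(J b)] with [g] gives [b^T J^T L g], the transpose of [(L g)^T J b],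
    which is the Jacobi term. *)
Lemma HH_term_chart x a b g (c := chart_at x) :
  (forall w, w *m trans_mx = 0 -> w *m a = 0) ->
  (forall w, w *m trans_mx = 0 -> w *m b = 0) ->
  HH_term h (chart_form c a) (chart_form c b) (chart_form c g) x =
  jacobi_term (bivf c) (c x) a b g ord0 ord0.
Proof.
move=> a0 b0; have ac := chart_at_atlas x; have cx := chart_at_dom x.
have cu := mem_cimg_dom cx.
have Xc : {near c x, vrep c (Hmap h (chart_form c a)) =1 const_comb (bivf c) a}.
  by apply: vrep_near => // y cy; exact: Hmap_chart_form.
have bc : {near c x, crep c (chart_form c b) =1 fun=> b}.
  apply: (eq_on_near (@cimg_open _ _ _ _ c)) cu => u uc.
  have := crepE (chart_form c b) (cinv_dom uc); rewrite (cinvK uc) => ->.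
  by rewrite /chart_form mulmxA coframeK ?mul1mx//; exact: cinv_dom.
have sL := smooth_bivec ham ext ac.
have dL := smooth_on_differentiable sL cu.
have dC : differentiable (const_comb (bivf c) a) (c x).
  exact: differentiable_mulmx (differentiable_cst a^T (c x)) dL.
have dX : differentiable (vrep c (Hmap h (chart_form c a))) (c x).
  by apply: near_eq_differentiable dC; apply: filterS Xc => y ->.
set J := 'J (const_comb (bivf c) a) (c x).
have LieE : lie_derivative (Hmap h (chart_form c a)) (chart_form c b) x = J *m b.
  rewrite /lie_derivative -/c (near_eq_derive _ bc) derive_cst add0r.
  by rewrite (near_eq_jacobian Xc dX) (nbhs_singleton bc).
(* [bivec] computes [h] on conormal covectors only. For a leaf vector [v], [v J] is again a leaf
   vector by [foliated_const_comb], and [b] annihilates it. *)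
have cJb : conormal x (J *m b).
  apply/conormalP => v /(TF_frame _ ac cx).
  rewrite frame_chart_at mulmx1 => v0; rewrite mulmxA.
  by apply: b0; rewrite -(deriveEjacobian v dC); exact: foliated_const_comb.
rewrite /HH_term /Hmap LieE /pairing (hvec_conormal ham ext ac cx cJb).
rewrite /chart_form frame_chart_at coframe_chart_at !mul1mx mulmx1.
rewrite /jacobi_term -(derive_const_comb sL)//.
have -> : bivf c (c x) = bivec h E c x by rewrite /= cmapK.
rewrite (deriveEjacobian _ dC) -/J; apply: (congr1 (fun A : 'M[R]_1 => A ord0 ord0)).
by rewrite -[RHS]mx11_trmx !trmx_mul !trmxK !mulmxA.
Qed.

Lemma jacobiator_bivec x a b g (c := chart_at x) :
  jacobiator (bivf c) (c x) a b g = 0.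
Proof.
have ac := chart_at_atlas x; have cx := chart_at_dom x.
have cu := mem_cimg_dom cx; have sL := smooth_bivec ham ext ac.
have skL u : (c @` cdom c) u -> (bivf c u)^T = - bivf c u.
  by move=> _; exact: (bivec_skew ham ext).
have LP : bivf c (c x) *m projc E c x = bivf c (c x).
  by rewrite /= cmapK//; apply: bivec_proj.
move: a b g; apply: (jacobiator_proj (@cimg_open _ _ _ _ c) sL skL cu LP).
  by move=> a b; rewrite -lie_bracket_hvec; exact: tame_bracket.
move=> a b g.
have P0 (e : 'cV[R]_(p + q)) w : w *m trans_mx = 0 -> w *m (projc E c x *m e) = 0.
  by move=> w0; apply: (projc_trans ext).
(* From here on the projected covectors enter only through their vanishing on leaf directions. *)
move: (projc E c x *m a) (projc E c x *m b) (projc E c x *m g) (P0 a) (P0 b) (P0 g).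
move=> {}a {}b {}g a0 b0 g0.
have := ham_jacobi ham (@cdom_open _ _ _ _ c) (projectable_chart_form ac a0)
  (projectable_chart_form ac b0) (projectable_chart_form ac g0) cx.
rewrite /HH_bracket !HH_term_chart// => /eqP; rewrite mulf_eq0 pnatr_eq0/= => /eqP H.
by apply/matrixP => i j; rewrite !ord1 -[LHS]/(_ ord0 ord0) /jacobiator 2!mxE H mxE.
Qed.

End Jacobi.

(** * Linearity, skewness and Leibniz rule in coordinates *)

Section GradientRules.
Context {R : realType} {n : nat}.
Implicit Types (f g k : 'rV[R]_n -> R^o) (u : 'rV[R]_n).

Lemma grad_comb (r : R) f g u : differentiable f u -> differentiable g u ->
  grad (fun v => r * f v + g v : R^o) u = r *: grad f u + grad g u.
Proof.
move=> df dg; apply/matrixP => i j; rewrite !mxE.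
have df' := diff_derivable (v := delta_mx ord0 i) df.
have dg' := diff_derivable (v := delta_mx ord0 i) dg.
apply: etrans (deriveD (derivableZ (k := r) df') dg') _.
by congr (_ + _); apply: etrans (deriveZ r df') _.
Qed.

Lemma grad_mul f g u : differentiable f u -> differentiable g u ->
  grad (fun v => f v * g v : R^o) u = f u *: grad g u + g u *: grad f u.
Proof.
move=> df dg; apply/matrixP => i j; rewrite !mxE.
have df' := diff_derivable (v := delta_mx ord0 i) df.
have dg' := diff_derivable (v := delta_mx ord0 i) dg.
exact: (deriveM df' dg').
Qed.

Variable L : 'rV[R]_n -> 'M[R]_n.

Lemma bivector_bracket_skew f g u : (L u)^T = - L u ->
  bivector_bracket L f g u = - bivector_bracket L g f u.
Proof.
move=> Lsk; rewrite /bivector_bracket; move: (grad f u) (grad g u) => a b.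
have -> : a^T *m L u *m b = - (b^T *m L u *m a).
  by rewrite -[LHS]mx11_trmx !trmx_mul trmxK mulmxA Lsk mulmxN mulNmx.
by rewrite mxE.
Qed.

Lemma near_eq_bivector_bracket f g k u : {near u, f =1 g} ->
  bivector_bracket L f k u = bivector_bracket L g k u.
Proof. by move=> fg; rewrite /bivector_bracket (near_eq_grad fg). Qed.

Lemma bivector_bracket_combl (r : R) f g k u :
  differentiable f u -> differentiable g u ->
  bivector_bracket L (fun v => r * f v + g v : R^o) k u =
  r * bivector_bracket L f k u + bivector_bracket L g k u.
Proof.
move=> df dg; rewrite /bivector_bracket (grad_comb r df dg).
move: (grad f u) (grad g u) (grad k u) => a b d.
by rewrite linearD linearZ/= !mulmxDl -!scalemxAl [LHS]mxE [X in X + _]mxE.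
Qed.

Lemma bivector_bracket_mulr f g k u :
  differentiable g u -> differentiable k u ->
  bivector_bracket L f (fun v => g v * k v : R^o) u =
  bivector_bracket L f g u * k u + g u * bivector_bracket L f k u.
Proof.
move=> dg dk; rewrite /bivector_bracket (grad_mul dg dk).
move: (grad f u) (grad g u) (grad k u) => a b d.
rewrite mulmxDr -!scalemxAr [LHS]mxE [X in X + _]mxE [X in _ + X]mxE.
by rewrite addrC [X in X + _]mulrC.
Qed.

End GradientRules.

(** * The Poisson structure on the manifold *)

Section Poisson.
Context {R : realType} {p q : nat} {M : foliatedManifold R p q}.
Context (h : M -> 'cV[R]_(p + q) -> 'rV[R]_(p + q)) (E : M -> 'M[R]_(p + q)).
Hypothesis ham : hamiltonian_structure h.
Hypothesis ext : image_extension h E.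
Local Notation atlas := (@fol_atlas R p q M).
Implicit Types (c : chart R p q M) (x : M) (f g k : M -> R).

Local Notation bivf c := (bivec h E c \o cinv c).
Local Notation loc c f := (f \o cinv c : 'rV[R]_(p + q) -> R^o).

Lemma differentiable_loc c f x : atlas c -> cdom c x -> smooth_fun f ->
  differentiable (loc c f) (c x).
Proof.
by move=> ac cx sf; exact: smooth_on_differentiable (sf c ac) (mem_cimg_dom cx).
Qed.

Lemma bracket_loc c f g u : atlas c -> smooth_fun f -> smooth_fun g ->
  (c @` cdom c) u ->
  bivector_bracket (bivf c) (loc c f) (loc c g) u = (bracket' h E f g \o cinv c) u.
Proof.
move=> ac sf sg cu; have cx := cinv_dom cu; rewrite /= (bracket_bivec ham ext ac cx).
- by rewrite (cinvK cu).
- exact: differentiable_loc.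
- exact: differentiable_loc.
Qed.

Lemma bracket_at f g x (c := chart_at x) : smooth_fun f -> smooth_fun g ->
  bracket' h E f g x = bivector_bracket (bivf c) (loc c f) (loc c g) (c x).
Proof.
move=> sf sg; have cx := chart_at_dom x.
apply: etrans _ (esym (bracket_loc (chart_at_atlas x) sf sg (mem_cimg_dom cx))).
by rewrite /= cmapK.
Qed.

Lemma smooth_fun_bracket' f g : smooth_fun f -> smooth_fun g ->
  smooth_fun (bracket' h E f g).
Proof.
move=> sf sg c ac; have oc := @cimg_open _ _ _ _ c.
have sB := smooth_bracket oc (smooth_bivec ham ext ac) (sf c ac) (sg c ac).
by apply: eq_smooth_on oc _ sB => u cu; exact: bracket_loc.
Qed.

Lemma smooth_fun_comb (r : R) f g : smooth_fun f -> smooth_fun g ->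
  smooth_fun (fun y => r * f y + g y).
Proof.
move=> sf sg c ac k; have oc := @cimg_open _ _ _ _ c.
apply: (Ck_on_add oc) (sg c ac k).
exact: (Ck_on_mul oc (Ck_on_cst k _ (r : R^o)) (sf c ac k)).
Qed.

Lemma smooth_fun_mul f g : smooth_fun f -> smooth_fun g ->
  smooth_fun (fun y => f y * g y).
Proof.
move=> sf sg c ac; have oc := @cimg_open _ _ _ _ c.
exact: smooth_on_mul oc (sf c ac) (sg c ac).
Qed.

(** Each identity is checked at a point [x] in the chart [chart_at x], where the bracket is the one
    of the matrix function [bivec]. *)
Lemma bracket_poisson : poisson_structure (bracket' h E).
Proof.
split.
- exact: smooth_fun_bracket'.
- move=> r f g k sf sg sk x; have ac := chart_at_atlas x; have cx := chart_at_dom x.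
  apply: etrans (bracket_at x (smooth_fun_comb r sf sg) sk) _.
  apply: etrans (bivector_bracket_combl _ r _ (differentiable_loc ac cx sf)
    (differentiable_loc ac cx sg)) _.
  by rewrite (bracket_at x sf sk) (bracket_at x sg sk).
- move=> f g sf sg x; rewrite (bracket_at x sf sg) (bracket_at x sg sf).
  by apply: bivector_bracket_skew; exact: (bivec_skew ham ext).
- move=> f g k sf sg sk x; have ac := chart_at_atlas x; have cx := chart_at_dom x.
  apply: etrans (bracket_at x sf (smooth_fun_mul sg sk)) _.
  apply: etrans (bivector_bracket_mulr _ _ (differentiable_loc ac cx sg)
    (differentiable_loc ac cx sk)) _.
  by rewrite (bracket_at x sf sg) (bracket_at x sf sk) /= cmapK.
- move=> f g k sf sg sk x; have ac := chart_at_atlas x; have cx := chart_at_dom x.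
  have cu := mem_cimg_dom cx; have oc := @cimg_open _ _ _ _ (chart_at x).
  have sL := smooth_bivec ham ext ac.
  have br2 (a b d : M -> R) : smooth_fun a -> smooth_fun b -> smooth_fun d ->
      bracket' h E (bracket' h E a b) d x =
      bivector_bracket (bivf (chart_at x)) (bivector_bracket (bivf (chart_at x))
        (loc (chart_at x) a) (loc (chart_at x) b)) (loc (chart_at x) d) (chart_at x x).
    move=> sa sb sd; apply: etrans (bracket_at x (smooth_fun_bracket' sa sb) sd) _.
    (* The outer bracket sees only the gradient of the inner one, so equality on the chart image, a
       neighbourhood of the point, suffices. *)
    apply: near_eq_bivector_bracket; apply: (eq_on_near oc) cu => u cu.
    by apply: esym; exact: bracket_loc.
  rewrite (br2 f g k sf sg sk) (br2 g k f sg sk sf) (br2 k f g sk sf sg).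
  apply: (jacobi_bracket oc sL cu) => //.
  + exact: (bivec_skew ham ext).
  + exact: jacobiator_bivec.
  + exact: sf.
  + exact: sg.
  + exact: sk.
Qed.

End Poisson.

Theorem proposition3p2 (R : realType) (p q : nat) (M : foliatedManifold R p q)
    (h : M -> 'cV[R]_(p + q) -> 'rV[R]_(p + q)) (E : M -> 'M[R]_(p + q))
    (hham : hamiltonian_structure h) (htame : tame h)
    (hE : image_extension h E) :
  poisson_structure (bracket' h E).
Proof. exact: bracket_poisson hham hE. Qed.
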